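(* Consider a discrete-time controlled Markov process satisfying conditions (A), (B) and (L) of the context. Then the following hold. (i) There exists a unique function $\psi^*:S\to(0,\infty)$ with $\psi^*(i_0)=1$ satisfying $$e^{\lambda^*}\psi^*(i)=\min_{u\in\mathbb U(i)}\Big[e^{c(i,u)}\sum_{j\in S}\psi^*(j)P(j|i,u)\Big]\qquad\text{for all } i\in S .$$ (ii) A stationary Markov control $v\in\mathfrak U_{\mathsf{sm}}$ is optimal if and only if $$\min_{u\in\mathbb U(i)}\Big[e^{c(i,u)}\sum_{j\in S}\psi^*(j)P(j|i,u)\Big]=e^{c(i,v(i))}\sum_{j\in S}\psi^*(j)P(j|i,v(i))\qquad\text{for all } i\in S .$$
   Context: Discrete-time controlled Markov process (DTCMP). The state space is $S=\{1,2,\dots\}$. The action space $\mathbb U$ is a Borel space; for each $i\in S$, $\mathbb U(i)\subset\mathbb U$ is a nonempty compact Borel set of admissible actions; $\mathscr K=\{(i,u):i\in S,\ u\in\mathbb U(i)\}$. $P(\cdot|i,u)$ is a stochastic kernel on $S$ depending measurably on $(i,u)\in\mathscr K$, $P(j|i,u)=P(\{j\}|i,u)$, and $c:\mathscr K\to[0,\infty)$ is the one-stage cost. A history up to time $t$ is $h_t=(x_0,u_0,\dots,x_{t-1},u_{t-1},x_t)$ with $(x_s,u_s)\in\mathscr K$, $x_t\in S$. An admissible control is a sequence $\zeta=(\zeta_t)_{t\ge0}$ of measurable maps from histories to $\mathbb U$ with $\zeta_t(h_t)\in\mathbb U(x_t)$; the set of these is $\mathfrak U$. For $i\in S$, $\zeta\in\mathfrak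 U$, $\mathbb P_i^\zeta$ (expectation $\mathbb E_i^\zeta$) is the unique probability measure on $(S\times\mathbb U)^\infty$ under which $X_0=i$ and, conditionally on the history up to time $t$ (with $\zeta_t$ also denoting the action used at time $t$), $X_{t+1}\in A$ with probability $P(A|X_t,\zeta_t)$. $\mathfrak U_{\mathsf{sm}}$ is the set of stationary Markov controls: $\zeta_t(h_t)=v(x_t)$ for a map $v:S\to\mathbb U$ with $v(i)\in\mathbb U(i)$; we identify the control with $v$. Cost: $\mathscr E_i(c,\zeta)=\limsup_{T\to\infty}\frac1T\log\mathbb E_i^\zeta\big[e^{\sum_{t=0}^{T-1}c(X_t,\zeta_t)}\big]$ and $\lambda^*=\inf_{i\in S}\inf_{\zeta\in\mathfrak U}\mathscr E_i(c,\zeta)$. A control $\zeta^*\in\mathfrak U$ is optimal if $\mathscr E_i(c,\zeta^* )=\lambda^*$ for all $i\in S$. A function $g:S\to\mathbb R$ is norm-like if $\{i:g(i)\le\kappa\}$ is finite (or empty) for every $\kappa\in\mathbb R$. (A) For each $i\in S$ and each bounded $f:S\to\mathbb R$, the maps $u\mapsto c(i,u)$ and $u\mapsto\sum_{j}f(j)P(j|i,u)$ are continuous on $\mathbb U(i)$. (B) There is a (fixed) state $i_0\in S$ such that $P(j|i_0,u)>0$ for all $j\in S\setminus\{i_0\}$ and $u\in\mathbb U(i_0)$. (L) The process is irreducible under every $v\in\mathfrak U_{\mathsf{sm}}$, and there are a function $\mathcal V:S\to[1,\infty)$, a constant $\widehat C>0$ and a finite set $\mathcal K\subset S$ such that one of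 the following holds. (a) For some $\beta\in(0,1)$, $\sup_{u\in\mathbb U(i)}\sum_{j}\mathcal V(j)P(j|i,u)\le(1-\beta)\mathcal V(i)+\widehat C\,\mathbf 1_{\mathcal K}(i)$ for all $i\in S$, and $\|c\|_\infty:=\sup_{i}\sup_{u\in\mathbb U(i)}c(i,u)<\gamma$, where $\gamma=\log\frac1{1-\beta}$. (b) For some norm-like $\ell:S\to[0,\infty)$, $\sup_{u\in\mathbb U(i)}\sum_{j}\mathcal V(j)P(j|i,u)\le\widehat C\,\mathbf 1_{\mathcal K}(i)+(1-\beta_i)\mathcal V(i)$ for all $i\in S$, where $\beta_i=1-e^{-\ell(i)}$; moreover $i\mapsto\ell(i)-\max_{u\in\mathbb U(i)}c(i,u)$ is norm-like. *)

(* Defs.v *)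
(* The countable state space S = {1, 2, ...} is relabelled as nat, with its
   discrete sigma-algebra. *)
From HB Require Import structures.
From mathcomp Require Import all_boot all_order all_algebra.
From mathcomp Require Import all_classical all_reals all_analysis.
From mathcomp Require Import measurable_realfun.

Set Implicit Arguments.
Unset Strict Implicit.
Unset Printing Implicit Defensive.

Import Order.TTheory GRing.Theory Num.Theory.
Import numFieldNormedType.Exports.

Local Open Scope classical_set_scope.
Local Open Scope ring_scope.

(* A Borel space is a Borel subset of a Polish space T: a completely metrized
   Hausdorff space (so that the pseudometric separates points) with a countable
   dense subset. *)
Definition polish_space (R : realType) (T : completePseudoMetricType R) :=
  hausdorff_space T /\ exists2 D : set T, countable D & dense D.

Definition borel (R : realType) (T : completePseudoMetricType R) :=
  g_sigma_algebraType (@open T).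
HB.instance Definition _ (R : realType) (T : completePseudoMetricType R) :=
  Measurable.on (borel T).

(* The space of sequences ((x_t, u_t))_t with the product sigma-algebra. *)
Definition trajectory (R : realType) (T : completePseudoMetricType R) :=
  g_sigma_algebraType
    (\bigcup_t preimage_set_system setT
       (fun w : nat -> nat * borel T => w t) measurable).
HB.instance Definition _ (R : realType) (T : completePseudoMetricType R) :=
  Measurable.on (trajectory T).

Section dtcmp.
Context {R : realType}.

(* [transition] and [cost] are total functions, but only their values at pairs
   (i, u) with u in [adm i] are ever constrained or used. *)
Record dtcmp (T : completePseudoMetricType R) := DTCMP {
  actions : set T ;
  measurable_actions : measurable (actions : set (borel T)) ;
  adm : nat -> set T ;
  adm_sub : forall i, adm i `<=` actions ;
  adm_nonempty : forall i, adm i !=set0 ;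
  adm_compact : forall i, compact (adm i) ;
  measurable_adm : forall i, measurable (adm i : set (borel T)) ;
  transition : nat -> T -> probability nat R ;
  measurable_transition : forall A : set nat,
    measurable_fun [set x : nat * borel T | adm x.1 x.2]
      (fun x : nat * borel T => transition x.1 x.2 A) ;
  cost : nat -> T -> R ;
  cost_ge0 : forall i u, adm i u -> 0 <= cost i u }.

Section controls.
Context {T : completePseudoMetricType R} (M : dtcmp T).

(* ((x_0, u_0), ..., (x_(t-1), u_(t-1))) and x_t *)
Definition history (t : nat) := (t.-tuple (nat * borel T) * nat)%type.

Definition adm_history (t : nat) : set (history t) :=
  [set h | forall s : 'I_t, adm M (tnth h.1 s).1 (tnth h.1 s).2].

Record control := Control {
  control_fun :> forall t, history t -> borel T ;
  measurable_control : forall t,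
    measurable_fun (@adm_history t) (@control_fun t) ;
  control_adm : forall t h, @adm_history t h -> adm M h.2 (control_fun h) }.

Record stationary := Stationary {
  stationary_fun :> nat -> borel T ;
  stationary_adm : forall i, adm M i (stationary_fun i) }.

Definition control_of_stationary (v : stationary) : control.
Proof.
refine (@Control (fun t h => v h.2) _ _).
- move=> t; apply: measurable_funTS.
  exact: (@measurableT_comp _ _ _ _ _ _ (v : nat -> borel T)).
- by move=> t h _; exact: stationary_adm.
Defined.

End controls.

Section law.
Context {T : completePseudoMetricType R} (M : dtcmp T).

Definition state (t : nat) (w : trajectory T) : nat := (w t).1.

Definition action (t : nat) (w : trajectory T) : borel T := (w t).2.

Definition past (t : nat) (w : trajectory T) : history (T := T) t :=
  ([tuple w s | s < t], state t w).

Definition is_law (i : nat) (z : control M) (Pr : probability (trajectory T) R) :=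
  [/\ Pr [set w | state 0 w = i] = 1%E,
      {ae Pr, forall w, forall t, action t w = z t (past t w)}
    & forall (t : nat) (B : set (history (T := T) t)) (A : set nat),
        measurable B -> B `<=` @adm_history T M t ->
        Pr [set w | B (past t w) /\ A (state t.+1 w)] =
        (\int[Pr]_(w in [set w | B (past t w)])
           transition M (state t w) (z t (past t w)) A)%E].

(* The law of the process started at i under z: by the Ionescu-Tulcea theorem
   there is exactly one probability measure satisfying [is_law i z], so that the
   default value is irrelevant. *)
Definition law (i : nat) (z : control M) : probability (trajectory T) R :=
  xget (\d_(point : trajectory T) : probability (trajectory T) R) (is_law i z).

(* Sequences in K^oo, a set of full measure under each [law i z]; the cost is only
   defined on K. *)
Definition adm_trajectory : set (trajectory T) :=
  [set w | forall t, adm M (state t w) (action t w)].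

Definition exp_cost (i : nat) (z : control M) (n : nat) : \bar R :=
  (\int[law i z]_(w in adm_trajectory)
     (expR (\sum_(t < n) cost M (state t w) (action t w)))%:E)%E.

Definition risk_cost (i : nat) (z : control M) : \bar R :=
  limn_esup (fun n => (n%:R^-1)%:E * lne (exp_cost i z n))%E.

Definition opt_cost : \bar R :=
  ereal_inf (range (fun i => ereal_inf (range (risk_cost i)))).

Definition optimal (z : control M) := forall i, risk_cost i z = opt_cost.

Definition irreducible (v : stationary M) := forall i j, exists t,
  (0 < law i (control_of_stationary v) [set w | state t w = j])%E.

End law.

Section conditions.
Context {T : completePseudoMetricType R} (M : dtcmp T).

Definition norm_like (g : nat -> R) :=
  forall k, finite_set [set i | g i <= k].

Definition avg (f : nat -> R) (i : nat) (u : T) : \bar R :=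
  (\sum_(0 <= j <oo) (f j)%:E * transition M i u [set j])%E.

Definition condA := forall i,
  {within adm M i, continuous (cost M i)} /\
  forall f : nat -> R, (exists C : R, forall j, `|f j| <= C) ->
    {within adm M i, continuous (avg f i)}.

Definition condB (i0 : nat) := forall j u, j <> i0 -> adm M i0 u ->
  (0 < transition M i0 u [set j])%E.

Definition condLa (V : nat -> R) (C : R) (K : set nat) :=
  exists beta : R, [/\ 0 < beta < 1,
    forall i, (ereal_sup [set avg V i u | u in adm M i] <=
               ((1 - beta) * V i + C * \1_K i)%:E)%E
  & (ereal_sup (range (fun i => ereal_sup [set (cost M i u)%:E | u in adm M i]))
     < (ln (1 / (1 - beta)))%:E)%E].

(* Under [condA] the real supremum of [cost M i] over the nonempty compact set
   [adm M i] is its maximum. *)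
Definition condLb (V : nat -> R) (C : R) (K : set nat) :=
  exists l : nat -> R, let beta i := 1 - expR (- l i) in
  [/\ forall i, 0 <= l i,
      norm_like l,
      forall i, (ereal_sup [set avg V i u | u in adm M i] <=
                 (C * \1_K i + (1 - beta i) * V i)%:E)%E
    & norm_like (fun i => l i - sup [set cost M i u | u in adm M i])].

Definition condL :=
  (forall v : stationary M, irreducible v) /\
  exists (V : nat -> R) (C : R) (K : set nat),
    [/\ forall i, 1 <= V i, 0 < C, finite_set K & condLa V C K \/ condLb V C K].

Definition bellman (psi : nat -> R) (i : nat) (u : T) : \bar R :=
  ((expR (cost M i u))%:E * avg psi i u)%E.

Definition is_min (D : set T) (F : T -> \bar R) (m : \bar R) :=
  (exists2 u, D u & F u = m) /\ forall u, D u -> (m <= F u)%E.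

Definition eigenfunction (i0 : nat) (psi : nat -> R) :=
  [/\ forall i, 0 < psi i,
      psi i0 = 1
    & forall i, is_min (adm M i) (bellman psi i)
                  (expeR (opt_cost M) * (psi i)%:E)%E].

End conditions.
End dtcmp.

(* Main.v *)
Require Import Defs.
From HB Require Import structures.
From mathcomp Require Import all_boot all_order all_algebra.
From mathcomp Require Import all_classical all_reals all_analysis.
From mathcomp Require Import measurable_realfun ring lra.

(** Write Q_u f (i) for e^{c(i,u)} sum_j f(j) P(j|i,u) ([kern]), and Q_v for
the kernel obtained by playing u = v(i) ([skern]). Actions are deterministic
functions of the history, so the expected exponential cost over n steps is an
n-fold composition of these kernels ([integral_payoff]). Apart from the
existence of the laws, the whole argument is therefore about nonnegative
functions on the state space and the positive operators Q_u.

Conditions (a) and (b) both give a function V >= 1, a rate d > 0 and a finite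
set K with Q_u V <= e^{-d} V + C 1_K for all actions ([foster_lyapunov]). If a
positive function psi satisfies Q_v psi <= e^r psi with r >= 0, then the
function V + A psi is at least 1, and for large A its growth factor under Q_v
is as close to e^r as desired; hence v costs at most r
([risk_cost_le_super]). Conversely, if some control costs less than r, then
the sum over k of e^{-rk} times the exponential cost over k steps, minimized
over controls, is finite and is a positive supersolution of rate r
([supersolution_above]).

The eigenfunction is a first-passage functional. Let g_r be the smallest
nonnegative solution of g = e^{-r} min_u Q_u h, where h equals g off i0 and 1
at i0: g_r(i) is the least expectation of e^{sum (c - r)} up to the next visit
to i0. For r above lambda*, a supersolution of rate r divided by its value at
i0 lies above g_r, so that g_r(i0) <= 1, and this inequality passes to the
limit r = lambda* ([stopped_value_le1]). If g(i0) < 1 at lambda*, then h is a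
supersolution with some slack at i0. Irreducibility spreads the slack to all of
K in finitely many steps, V provides slack off K, and the two combine into a
function whose growth factor under a minimizing stationary control is smaller
than e^{lambda*} ([strict_lowers_risk]), which contradicts the definition of
lambda*. So g(i0) = 1, and h = g is an eigenfunction.

By minimality every other eigenfunction lies above h. It touches h at i0, from
where all the other states are reached in one step, so it is equal to h
([kern_touch]). The same comparison, carried out with the action sets {v(i)},
shows that an optimal stationary control v attains the minimum. The converse
implication is the upper bound on the cost of v recalled above. *)

Set Implicit Arguments.
Unset Strict Implicit.
Unset Printing Implicit Defensive.

Import Order.TTheory GRing.Theory Num.Theory.
Import numFieldNormedType.Exports.

Local Open Scope classical_set_scope.
Local Open Scope ring_scope.
Local Open Scope ereal_scope.

(** * Averages over the next state *)

Section mean.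
Context {R : realType} (p : probability nat R).
Implicit Types f g : nat -> \bar R.

Definition mean f : \bar R := \sum_(0 <= j <oo) f j * p [set j].

Lemma mean_ge0 f : (forall j, 0 <= f j) -> 0 <= mean f.
Proof. by move=> f0; apply: nneseries_ge0 => j _ _; exact: mule_ge0. Qed.

Lemma le_mean f g : (forall j, 0 <= f j) -> (forall j, f j <= g j) ->
  mean f <= mean g.
Proof.
move=> f0 fg; apply: lee_nneseries => [j _ _|j _]; first exact: mule_ge0.
exact: lee_wpmul2r.
Qed.

Lemma meanD f g : (forall j, 0 <= f j) -> (forall j, 0 <= g j) ->
  mean (fun j => f j + g j) = mean f + mean g.
Proof.
move=> f0 g0; rewrite -nneseriesD => [|j _ _|j _ _]; try exact: mule_ge0.
by apply: eq_eseriesr => j _; rewrite ge0_muleDl.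
Qed.

Lemma meanZ (k : R) f : (forall j, 0 <= f j) ->
  mean (fun j => k%:E * f j) = k%:E * mean f.
Proof.
move=> f0; rewrite -nneseriesZl => [|j _]; last exact: mule_ge0.
by apply: eq_eseriesr => j _; rewrite muleA.
Qed.

Lemma mean_ge_term f j : (forall k, 0 <= f k) -> f j * p [set j] <= mean f.
Proof.
move=> f0; rewrite /mean (nneseriesD1 (n := j))// => [|k _]; last exact: mule_ge0.
by rewrite leeDl// nneseries_ge0// => k _ _; exact: mule_ge0.
Qed.

Lemma mean_indic (A : set nat) : mean (fun j => (\1_A j)%:E) = p A.
Proof.
transitivity (\sum_(0 <= j <oo) p (A `&` [set j])).
  apply: eq_eseriesr => j _; rewrite indicE.
  case: (boolP (j \in A)) => [/set_mem Aj|/negP Aj].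
    by rewrite mul1e setIidr// => k ->.
  rewrite mul0e (_ : _ `&` _ = set0) ?measure0//.
  by apply/seteqP; split=> // k [Ak kj]; apply: Aj; rewrite -kj; exact: mem_set.
rewrite (eq_eseriesl (Q := mem setT)) => [|j]; last by apply/esym/asboolP.
rewrite -measure_bigcup//.
- by congr (p _); rewrite -setI_bigcupr bigcup_imset1 image_id setIT.
- by move=> i j _ _ [k [[_ ->] [_ ->]]].
Qed.

Lemma mean_cst (k : R) : (0 <= k)%R -> mean (cst k%:E) = k%:E.
Proof.
move=> k0; have := mean_indic setT; rewrite probability_setT => m1.
rewrite -[RHS]mule1 -m1 -meanZ => [|j]; last by rewrite lee_fin.
by congr mean; apply/funext => j; rewrite indicT mule1.
Qed.

(** Monotone convergence, applied below to truncations that increase to an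
unbounded function. *)
Lemma mean_sup (F : nat -> nat -> \bar R) (m : \bar R) :
  (forall k j, 0 <= F k j) -> (forall j, {homo F^~ j : k l / (k <= l)%N >-> k <= l}) ->
  (forall k, mean (F k) <= m) ->
  mean (fun j => ereal_sup (range (F^~ j))) <= m.
Proof.
move=> F0 Fnd Fm.
have S0 j : 0 <= ereal_sup (range (F^~ j)).
  by apply: le_trans (F0 0%N j) _; apply: ereal_sup_ubound; exists 0%N.
apply: lime_le.
  by apply: is_cvg_nneseries => j _ _; exact: mule_ge0.
apply: nearW => n.
have Fcvg j : F^~ j @ \oo --> ereal_sup (range (F^~ j)).
  by apply: ereal_nondecreasing_cvgn; exact: Fnd.
have cv : (fun k => \sum_(0 <= j < n) F k j * p [set j]) @ \oo -->
    \sum_(0 <= j < n) ereal_sup (range (F^~ j)) * p [set j].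
  apply: cvg_nnesum => j _; first by apply: nearW => k; exact: mule_ge0.
  have pfin : p [set j] \is a fin_num by rewrite fin_num_measure.
  by rewrite -(fineK pfin); apply: cvgeZr.
rewrite -(cvg_lim _ cv)//; apply: lime_le; first by apply/cvg_ex; eexists; exact: cv.
apply: nearW => k; apply: le_trans (Fm k).
by apply: nneseries_lim_ge => j _ _; exact: mule_ge0.
Qed.

End mean.

Section compactness.
Context {R : realType} {T : topologicalType}.

(** Minimizers of the functions accumulate at a point of the compact set. Since
the sequence increases, that point satisfies all the bounds at once. *)
Lemma compact_inf_sup (D : set T) (G : nat -> T -> R) (m : \bar R) :
  compact D -> D !=set0 -> (forall k, {within D, continuous (G k)}) ->
  (forall k l u, (k <= l)%N -> D u -> (G k u <= G l u)%R) ->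
  (forall k, ereal_inf [set (G k u)%:E | u in D] <= m) ->
  exists2 u, D u & forall k, (G k u)%:E <= m.
Proof.
move=> cD D0 Gc Gnd Gm.
have min_at k : exists u, D u /\ (G k u)%:E <= m.
  have [u /set_mem Du umin] := compact_EVT_min D0 cD (Gc k).
  exists u; split=> //; apply: le_trans (Gm k); apply: le_ereal_inf_tmp.
  by move=> _ [v Dv <-]; rewrite lee_fin; apply: umin; exact: mem_set.
have [s sP] := choice min_at.
have Ds : (s @ \oo) D by exists 0%N => // k _; exact: (sP k).1.
have [u [Du cu]] := cD _ (fmap_proper_filter s _) Ds.
exists u => // k; rewrite leNgt; apply/negP => mG.
have nu : nbhs u [set x | D x -> m < (G k x)%:E].
  case: (ltP m (G k u)%:E) mG => // mG _.
  have [r mr rG] : exists2 r : R, m <= r%:E & (r < G k u)%R.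
    case: m mG {Gm min_at sP} => [r| |] mG; last 2 first.
    - by [].
    - by exists (G k u - 1)%R; [exact: leNye | rewrite ltrBlDr ltrDl].
    by exists r => //; rewrite -lte_fin.
  have /subspace_continuousP/(_ u Du) Gu := Gc k.
  have : within D (nbhs u) (G k @^-1` [set x | (r < x)%R]).
    by apply: Gu; exact: lt_nbhsr.
  apply: filterS => x /= rGx.
  by apply: le_lt_trans mr _; rewrite lte_fin.
have sk : (s @ \oo) [set x | exists2 l, (k <= l)%N & x = s l].
  by exists k => // l kl; exists l.
have [_ [[l kl ->] /(_ (sP l).1)]] := cu _ _ sk nu.
apply/negP; rewrite -leNgt; apply: le_trans (sP l).2.
by rewrite lee_fin Gnd//; exact: (sP l).1.
Qed.

End compactness.

(** * The weighted kernel and minimal solutions of optimality equations *)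

Section kernel.
Context {R : realType} {T : completePseudoMetricType R} (M : dtcmp T).
Implicit Types f g : nat -> \bar R.

(** The iterates of this kernel are the exponential costs: its total mass is
e^{c(i,u)}, not 1. *)
Definition kern f i u : \bar R :=
  (expR (cost M i u))%:E * mean (transition M i u) f.

Lemma kern_ge0 f i u : (forall j, 0 <= f j) -> 0 <= kern f i u.
Proof. by move=> f0; apply: mule_ge0; [rewrite lee_fin expR_ge0|exact: mean_ge0]. Qed.

Lemma le_kern f g i u : (forall j, 0 <= f j) -> (forall j, f j <= g j) ->
  kern f i u <= kern g i u.
Proof.
by move=> f0 fg; apply: lee_wpmul2l; [rewrite lee_fin expR_ge0|exact: le_mean].
Qed.

Lemma kernD f g i u : (forall j, 0 <= f j) -> (forall j, 0 <= g j) ->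
  kern (fun j => f j + g j) i u = kern f i u + kern g i u.
Proof.
move=> f0 g0; rewrite /kern meanD// ge0_muleDr//; exact: mean_ge0.
Qed.

Lemma kernZ (k : R) f i u : (forall j, 0 <= f j) ->
  kern (fun j => k%:E * f j) i u = k%:E * kern f i u.
Proof. by move=> f0; rewrite /kern meanZ// muleCA. Qed.

Lemma kern_cst (k : R) i u : (0 <= k)%R ->
  kern (cst k%:E) i u = (expR (cost M i u) * k)%:E.
Proof. by move=> k0; rewrite /kern mean_cst. Qed.

Lemma mean_le_kern f i u : adm M i u -> (forall j, 0 <= f j) ->
  mean (transition M i u) f <= kern f i u.
Proof.
move=> iu f0; rewrite -[leLHS]mul1e; apply: lee_wpmul2r; first exact: mean_ge0.
by rewrite lee_fin -expR0 ler_expR cost_ge0.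
Qed.

Lemma kern_ge_term f i u j : adm M i u -> (forall k, 0 <= f k) ->
  f j * transition M i u [set j] <= kern f i u.
Proof.
by move=> iu f0; apply: le_trans (mean_le_kern iu f0); exact: mean_ge_term.
Qed.

Lemma kern_sup (F : nat -> nat -> \bar R) (m : \bar R) i u :
  (forall k j, 0 <= F k j) -> (forall j, {homo F^~ j : k l / (k <= l)%N >-> k <= l}) ->
  (forall k, kern (F k) i u <= m) ->
  kern (fun j => ereal_sup (range (F^~ j))) i u <= m.
Proof.
move=> F0 Fnd Fm; rewrite /kern -lee_pdivlMl ?expR_gt0//.
by apply: mean_sup => // k; rewrite lee_pdivlMl ?expR_gt0//; exact: Fm.
Qed.

End kernel.

Section value.
Context {R : realType} {T : completePseudoMetricType R} (M : dtcmp T).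
Hypothesis hA : condA M.
Variable D : nat -> set T.
Hypotheses (D_compact : forall i, compact (D i)) (D_neq0 : forall i, D i !=set0).
Hypothesis D_adm : forall i, D i `<=` adm M i.
Variables (r b : R) (Z : set nat).
Hypothesis b_ge0 : (0 <= b)%R.
Implicit Types f g : nat -> \bar R.

(** Reaching [Z] ends the process with the reward 1: a singleton gives
first-passage functionals, the empty set gives discounted ones. *)
Definition stop f j : \bar R := if j \in Z then 1 else f j.

Lemma stop_ge0 f : (forall j, 0 <= f j) -> forall j, 0 <= stop f j.
Proof. by move=> f0 j; rewrite /stop; case: ifP. Qed.

Lemma le_stop f g : (forall j, f j <= g j) -> forall j, stop f j <= stop g j.
Proof. by move=> fg j; rewrite /stop; case: ifP. Qed.

Definition stage_value f i u : \bar R := b%:E + (expR (- r))%:E * kern M (stop f) i u.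

Definition bellman_op f i : \bar R := ereal_inf [set stage_value f i u | u in D i].

Definition value_iter n : nat -> \bar R := iter n bellman_op (cst 0).

(** The limit of value iteration from 0, which increases; it may be infinite. *)
Definition value i : \bar R := ereal_sup (range (value_iter^~ i)).

Lemma le_stage_value f g i u : (forall j, 0 <= f j) -> (forall j, f j <= g j) ->
  stage_value f i u <= stage_value g i u.
Proof.
move=> f0 fg; apply: leeD2l; apply: lee_wpmul2l; first by rewrite lee_fin expR_ge0.
by apply: le_kern; [exact: stop_ge0|exact: le_stop].
Qed.

Lemma stage_value_ge0 f i u : (forall j, 0 <= f j) -> 0 <= stage_value f i u.
Proof.
move=> f0; apply: adde_ge0; rewrite ?lee_fin//.
apply: mule_ge0; rewrite ?lee_fin ?expR_ge0//.
by apply: kern_ge0; exact: stop_ge0.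
Qed.

Lemma value_iter_ge0 n i : 0 <= value_iter n i.
Proof.
elim: n i => [//|n IH] i; apply: le_ereal_inf_tmp => _ [u _ <-].
exact: stage_value_ge0.
Qed.

Lemma le_bellman_op f g : (forall j, 0 <= f j) -> (forall j, f j <= g j) ->
  forall i, bellman_op f i <= bellman_op g i.
Proof.
move=> f0 fg i; apply: le_ereal_inf_tmp => _ [u Du <-].
by apply: ge_ereal_inf; exists (stage_value f i u); [exists u|exact: le_stage_value].
Qed.

Lemma value_iter_nd i : {homo value_iter^~ i : n m / (n <= m)%N >-> n <= m}.
Proof.
apply/nondecreasing_seqP => n; elim: n i => [|n IH] i; first exact: value_iter_ge0.
by apply: le_bellman_op => // j; exact: value_iter_ge0.
Qed.

Lemma value_iter_le_value n i : value_iter n i <= value i.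
Proof. by apply: ereal_sup_ubound; exists n. Qed.

Lemma value_ge0 i : 0 <= value i.
Proof. exact: (le_trans (value_iter_ge0 0 i) (value_iter_le_value 0 i)). Qed.

(** Value iteration starts below any nonnegative supersolution and remains below
it. *)
Lemma value_le f : (forall j, 0 <= f j) ->
  (forall i, exists2 u, D i u & stage_value f i u <= f i) -> forall i, value i <= f i.
Proof.
move=> f0 ff i; apply: ge_ereal_sup => _ [n _ <-].
elim: n i => [//|n IH] i; have [u Du uf] := ff i.
apply: ge_ereal_inf; exists (stage_value (value_iter n) i u); first by exists u.
by apply: le_trans uf; apply: le_stage_value => // j; exact: value_iter_ge0.
Qed.

(** Truncation makes the stage value continuous in the action, by the continuity
hypothesis on averages of bounded functions. The level is [k.+1] and not [k] so
that the reward 1 is never cut. *)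
Let trunc k j : R := fine (mine (stop (value_iter k) j) k.+1%:R%:E).

Let truncE k j : (trunc k j)%:E = mine (stop (value_iter k) j) k.+1%:R%:E.
Proof.
rewrite /trunc fineK// ge0_fin_numE; last first.
  by rewrite le_min lee_fin ler0n andbT stop_ge0// => ?; exact: value_iter_ge0.
by rewrite gt_min ltry orbT.
Qed.

Let trunc_ge0 k j : (0 <= trunc k j)%R.
Proof.
rewrite -lee_fin truncE le_min lee_fin ler0n andbT stop_ge0// => ?.
exact: value_iter_ge0.
Qed.

Let trunc_le k j : (trunc k j <= k.+1%:R)%R.
Proof. by rewrite -lee_fin truncE ge_min lexx orbT. Qed.

Let trunc_nd k l j : (k <= l)%N -> (trunc k j <= trunc l j)%R.
Proof.
move=> kl; rewrite -lee_fin !truncE le_min !ge_min; apply/andP; split.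
  by rewrite le_stop// => ?; exact: value_iter_nd.
by rewrite lee_fin ler_nat ltnS kl orbT.
Qed.

Let stop_value_le j : stop value j <= ereal_sup (range (fun k => (trunc k j)%:E)).
Proof.
have tle k : (trunc k j)%:E <= ereal_sup (range (fun k => (trunc k j)%:E)).
  by apply: ereal_sup_ubound; exists k.
rewrite /stop; case: ifPn => jZ.
  apply: le_trans (tle 0%N); rewrite truncE /stop jZ.
  by rewrite le_min lexx.
apply: ge_ereal_sup => _ [n _ <-].
have tE k : (n <= k)%N -> mine (value_iter n j) k.+1%:R%:E <= (trunc k j)%:E.
  move=> nk; rewrite truncE /stop (negbTE jZ) le_min !ge_min lexx orbT andbT.
  by rewrite value_iter_nd.
case E : (value_iter n j) => [x| |]; last exact: leNye.
- have [k xk] : exists k, (x <= k.+1%:R)%R.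
    exists (Num.truncn x); apply/ltW/truncnS_gt.
  apply: le_trans (tle (maxn n k)); apply: le_trans (tE _ (leq_maxl _ _)).
  by rewrite E le_min lexx lee_fin (le_trans xk)// ler_nat ltnS leq_maxr.
- rewrite leye_eq; apply/eqP/eqyP => A A0.
  have kA : (A <= (Num.truncn A).+1%:R)%R by apply/ltW/truncnS_gt.
  apply: le_trans (tle (maxn n (Num.truncn A))).
  apply: le_trans (tE _ (leq_maxl _ _)).
  by rewrite E minye lee_fin (le_trans kA)// ler_nat ltnS leq_maxr.
Qed.

Let G i k u : R := (b + expR (- r) * (expR (cost M i u) *
  fine (avg M (trunc k) i u)))%R.

Let avg_fin k i u : adm M i u -> avg M (trunc k) i u \is a fin_num.
Proof.
move=> iu; rewrite ge0_fin_numE; last by apply: mean_ge0 => j; rewrite lee_fin.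
apply: le_lt_trans (_ : mean (transition M i u) (cst k.+1%:R%:E) < +oo).
  by apply: le_mean => j; rewrite lee_fin.
by rewrite mean_cst// ltry.
Qed.

Let GE k i u : adm M i u -> (G i k u)%:E =
  b%:E + (expR (- r))%:E * kern M (fun j => (trunc k j)%:E) i u.
Proof.
move=> iu; rewrite /G EFinD EFinM EFinM fineK//; exact: avg_fin.
Qed.

Let G_continuous i k : {within D i, continuous (G i k)}.
Proof.
apply: continuous_subspaceW (@D_adm i) _.
have [cc /(_ (trunc k)) ca] := hA i.
have {}ca : {within adm M i, continuous (avg M (trunc k) i)}.
  by apply: ca; exists k.+1%:R => j; rewrite ger0_norm.
apply/subspace_continuousP => u iu.
apply: cvgD; first exact: cvg_cst.
apply: cvgM; first exact: cvg_cst.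
apply: cvgM.
  move/subspace_continuousP : cc => /(_ _ iu) /= cc.
  exact: (cvg_comp _ _ cc (@continuous_expR R _)).
move/subspace_continuousP : ca => /(_ _ iu) /= ca.
by apply: fine_cvg; rewrite fineK//; exact: avg_fin.
Qed.

(** By compactness, one action is good for all the iterates at once; hence the
minimum over actions commutes with the limit of value iteration. *)
Lemma value_attained i : exists2 u, D i u & stage_value value i u <= value i.
Proof.
have [|k l u kl Du|k|u Du uG] :=
    @compact_inf_sup _ _ (D i) (G i) (value i) (D_compact (i:=i)) (D_neq0 i).
- exact: G_continuous.
- rewrite -lee_fin !GE; [|exact: D_adm..].
  apply: leeD2l; apply: lee_wpmul2l; first by rewrite lee_fin expR_ge0.
  by apply: le_kern => j; rewrite lee_fin// trunc_nd.
- apply: le_trans (value_iter_le_value k.+1 i).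
  apply: le_ereal_inf_tmp => _ [u Du <-].
  apply: ge_ereal_inf; exists (G i k u)%:E; first by exists u.
  rewrite GE; last exact: D_adm.
  apply: leeD2l; apply: lee_wpmul2l; first by rewrite lee_fin expR_ge0.
  by apply: le_kern => j; rewrite ?lee_fin// truncE ge_min lexx.
exists u => //.
have : kern M (fun j => ereal_sup (range (fun k => (trunc k j)%:E))) i u <=
    (expR r)%:E * (value i - b%:E).
  apply: kern_sup => [k j|j k l kl|k]; rewrite ?lee_fin//; first exact: trunc_nd.
  rewrite -lee_pdivrMl ?expR_gt0// -expRN leeBrDl//.
  by rewrite -GE//; exact: D_adm.
rewrite /stage_value -leeBrDl// expRN lee_pdivrMl ?expR_gt0//; apply: le_trans.
by apply: le_kern => //; apply: stop_ge0; exact: value_ge0.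
Qed.

Lemma value_le_stage_value i u : D i u -> value i <= stage_value value i u.
Proof.
move=> Du; apply: ge_ereal_sup => _ [[|n] _ <-].
  by apply: stage_value_ge0; exact: value_ge0.
apply: ge_ereal_inf; exists (stage_value (value_iter n) i u); first by exists u.
by apply: le_stage_value => j; [exact: value_iter_ge0|exact: value_iter_le_value].
Qed.

End value.

(** * Measurability on the space of trajectories *)

Section trajectories.
Context {R : realType} {T : completePseudoMetricType R} (M : dtcmp T).

Lemma measurable_coord t :
  measurable_fun setT (fun w : trajectory T => w t).
Proof.
move=> _ Y mY; apply: sub_sigma_algebra; exists t => //.
by exists Y.
Qed.

Lemma measurable_state t : measurable_fun setT (@state R T t).
Proof. exact: (measurableT_comp measurable_fst (measurable_coord t)). Qed.

Lemma measurable_action t : measurable_fun setT (@action R T t).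
Proof. exact: (measurableT_comp measurable_snd (measurable_coord t)). Qed.

Lemma measurable_past t : measurable_fun setT (@past R T t).
Proof.
apply: measurable_fun_pair; last exact: measurable_state.
apply/measurable_fun_tnthP => s.
rewrite (_ : _ \o _ = fun w : trajectory T => w s); first exact: measurable_coord.
by apply/funext => w /=; rewrite tnth_mktuple.
Qed.

Lemma measurable_pairs : measurable [set x : nat * borel T | adm M x.1 x.2].
Proof.
rewrite (_ : [set _ | _] = \bigcup_i ([set i] `*` (adm M i : set (borel T)))).
  by apply: bigcup_measurable => i _; apply: measurableX => //; exact: measurable_adm.
apply/seteqP; split => [[i u] /= iu|[i u] [j _ [/= -> //]]].
by exists i.
Qed.

Lemma measurable_adm_history t : measurable (@adm_history R T M t).
Proof.
rewrite (_ : @adm_history R T M t = \bigcap_(s : 'I_t)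
    ((fun h : history (T := T) t => tnth h.1 s) @^-1` [set x | adm M x.1 x.2])).
  apply: fin_bigcap_measurable => // s _; rewrite -[_ @^-1` _]setTI.
  apply: (measurableT_comp (measurable_tnth s) measurable_fst) => //.
  exact: measurable_pairs.
by apply/seteqP; split => [h hh s _|h hh s]; [exact: hh|exact: (hh s)].
Qed.

Lemma measurable_adm_trajectory : measurable (adm_trajectory M).
Proof.
rewrite (_ : adm_trajectory M = \bigcap_t
    ((fun w : trajectory T => w t) @^-1` [set x | adm M x.1 x.2])).
  apply: bigcap_measurable; first by exists 0%N.
  move=> t _; rewrite -[_ @^-1` _]setTI.
  by apply: measurable_coord => //; exact: measurable_pairs.
by apply/seteqP; split => [h hh s _|h hh s]; [exact: hh|exact: (hh s)].
Qed.

Lemma within_continuous_measurable (A : set T) (f : T -> R) :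
  measurable (A : set (borel T)) -> {within A, continuous f} ->
  measurable_fun (A : set (borel T)) (f : borel T -> R).
Proof.
move=> mA /continuousP cf; apply: (measurability _ (RGenOpens.measurableE R)).
move=> _ [_ [a [b ->] <-]].
have oab : open (f @^-1` `]a, b[%classic : set (subspace A)).
  by apply: cf; exact: interval_open.
have [U oU UA] := (open_subspaceP A _).1 oab.
rewrite setIC -UA; apply: measurableI => //.
exact: sub_sigma_algebra.
Qed.

Lemma measurable_cost : condA M ->
  measurable_fun [set x : nat * borel T | adm M x.1 x.2] (fun x => cost M x.1 x.2).
Proof.
move=> hA.
rewrite (_ : [set _ | _] = \bigcup_i ([set i] `*` (adm M i : set (borel T)))); last first.
  apply/seteqP; split => [[i u] /= iu|[i u] [j _ [/= -> //]]].
  by exists i.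
have mi i : measurable ([set i] `*` (adm M i : set (borel T))).
  by apply: measurableX => //; exact: measurable_adm.
apply/measurable_fun_bigcup => // i.
apply: (eq_measurable_fun (fun x : nat * borel T => cost M i x.2)).
  by move=> [j u] /set_mem[/= ->].
apply: (@measurable_comp _ _ _ _ _ _ (adm M i : set (borel T))
  (cost M i : borel T -> R) _ snd).
- exact: measurable_adm.
- by move=> _ [[j u] [_ iu] <-].
- by apply: within_continuous_measurable; [exact: measurable_adm|exact: (hA i).1].
- exact: measurable_funTS measurable_snd.
Qed.

Lemma measurable_singleton (hT : hausdorff_space T) (u : borel T) :
  measurable [set u].
Proof.
rewrite -[[set u]]setCK; apply: measurableC.
apply: sub_sigma_algebra; apply: closed_openC.
exact: (@accessible_closed_set1 _ (hausdorff_accessible hT)).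
Qed.

Lemma measurable_history1 (hT : hausdorff_space T) t (h : history (T := T) t) :
  measurable [set h].
Proof.
have m1 (x : nat * borel T) : measurable [set x].
  case: x => i u; rewrite (_ : [set _] = [set i] `*` [set u]); last first.
    by apply/seteqP; split => [_ ->//|[j v] [/= -> ->]].
  by apply: measurableX => //; exact: measurable_singleton.
rewrite (_ : [set h] = \bigcap_(s : 'I_t)
  ((fun h : history (T := T) t => tnth h.1 s) @^-1` [set tnth h.1 s]) `&`
  (snd @^-1` [set h.2])).
  apply: measurableI.
    apply: fin_bigcap_measurable => // s _; rewrite -[_ @^-1` _]setTI.
    exact: (measurableT_comp (measurable_tnth s) measurable_fst).
  by rewrite -[_ @^-1` _]setTI; exact: measurable_snd.
apply/seteqP; split => [_ ->//|[h1 h2] [/= e1 e2]].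
case: h e1 e2 => g1 g2 /= e1 e2; congr pair => //.
by apply: eq_from_tnth => s; exact: e1.
Qed.

End trajectories.

(** * Exponential costs as compositions of kernels *)

Section expectation.
Context {R : realType} {T : completePseudoMetricType R} (M : dtcmp T).
Variable z : control M.

Definition extend t (h : history (T := T) t) (j : nat) : history (T := T) t.+1 :=
  ([tuple of rcons h.1 (h.2, z t h)], j).

(** The expectation of [f] weighted by the exponential cost of the next [n] steps
after [h]. Only the next state is averaged, since the history determines the
action. *)
Fixpoint horizon (f : nat -> \bar R) n t (h : history (T := T) t) : \bar R :=
  if n is m.+1 then kern M (fun j => horizon f m (extend h j)) h.2 (z t h)
  else f h.2.

Lemma horizon_ge0 f n t (h : history (T := T) t) : (forall j, 0 <= f j) ->
  0 <= horizon f n h.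
Proof.
by move=> f0; elim: n t h => [|n IH] t h; [exact: f0|apply: kern_ge0 => j; exact: IH].
Qed.

Lemma adm_extend t (h : history (T := T) t) j :
  adm_history M h -> adm_history M (extend h j).
Proof.
move=> hh s; rewrite (tnth_nth (h.2, z t h)) /= nth_rcons size_tuple.
case: ltngtP => [st|ts|_]; last exact: control_adm.
  by have := hh (Ordinal st); rewrite (tnth_nth (h.2, z t h)).
by have := ltn_ord s; rewrite ltnS leqNgt ts.
Qed.

Lemma pastS t (w : trajectory T) :
  past t.+1 w = ([tuple of rcons (past t w).1 (w t)], state t.+1 w).
Proof.
congr pair; apply: eq_from_tnth => s.
rewrite tnth_mktuple (tnth_nth (w t)) /= nth_rcons size_map size_enum_ord.
case: ltngtP => [st|ts|->//].
  rewrite (nth_map (Ordinal st)) ?size_enum_ord//.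
  by congr w; rewrite nth_enum_ord.
by have := ltn_ord s; rewrite ltnS leqNgt ts.
Qed.

Lemma past_extend t (h : history (T := T) t) j (w : trajectory T) :
  past t.+1 w = extend h j <->
  [/\ past t w = h, action t w = z t h & state t.+1 w = j].
Proof.
rewrite pastS /extend; split.
- move=> [/rcons_inj[e1 e2] e3]; split => //.
  + case: h e1 e2 => h1 h2 /= e1 e2; rewrite /past; congr pair.
      exact: val_inj.
    by rewrite /state e2.
  + by rewrite /action e2.
- move=> [<- e2 <-]; congr pair; apply: val_inj => /=; congr rcons.
  by rewrite [LHS]surjective_pairing -e2.
Qed.

Hypothesis hA : condA M.
Hypothesis hT : hausdorff_space T.
Variables (i : nat) (Pr : probability (trajectory T) R).
Hypothesis Pr_law : is_law i z Pr.

Let at_past t (h : history (T := T) t) : set (trajectory T) := [set w | past t w = h].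

Let measurable_at_past t (h : history (T := T) t) : measurable (at_past h).
Proof.
rewrite -[at_past h]setTI.
exact: (measurable_past measurableT (measurable_history1 hT h)).
Qed.

(** Discarding these null events turns the almost sure relation between actions and
histories into identities between events. *)
Let deviation t (h : history (T := T) t) : set (trajectory T) :=
  at_past h `&` [set w | action t w <> z t h].

Let measurable_deviation t (h : history (T := T) t) : measurable (deviation h).
Proof.
apply: measurableI => //; rewrite (_ : [set _ | _] = ~` (action t @^-1` [set z t h]))//.
apply: measurableC; rewrite -[_ @^-1` _]setTI; apply: measurable_action => //.
exact: measurable_singleton.
Qed.

Let deviation_null t (h : history (T := T) t) : Pr (deviation h) = 0.
Proof.
apply/negligibleP => //; have [_ ae_z _] := Pr_law.
apply: negligibleS ae_z => w [wh wz] /= /(_ t).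
by rewrite wh.
Qed.

Lemma prob_extend t (h : history (T := T) t) j : adm_history M h ->
  Pr [set w | past t.+1 w = extend h j] =
  Pr [set w | past t w = h] * transition M h.2 (z t h) [set j].
Proof.
move=> hh; have [_ _ /(_ t [set h] [set j])] := Pr_law.
move=> /(_ (measurable_history1 hT h)) step.
transitivity (Pr ([set w | [set h] (past t w) /\ [set j] (state t.+1 w)])).
  rewrite (_ : [set w | [set h] _ /\ _] = at_past (extend h j) `|`
      (deviation h `&` (state t.+1 @^-1` [set j]))).
    rewrite measureU0//.
      by apply: measurableI => //; rewrite -[_ @^-1` _]setTI; exact: measurable_state.
    apply: subset_measure0 (deviation_null h) => //.
      by apply: measurableI => //; rewrite -[_ @^-1` _]setTI; exact: measurable_state.
  apply/seteqP; split => w /=.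
    move=> [wh wj]; have [wz|wz] := pselect (action t w = z t h).
      by left; apply/past_extend.
    by right.
  by move=> [/past_extend[]//|[[]]].
rewrite step; last by move=> _ ->.
rewrite (eq_integral (cst (transition M h.2 (z t h) [set j]))).
  by rewrite integral_cst; [rewrite muleC|exact: (measurable_at_past h)].
move=> w /set_mem /= wh; rewrite wh.
by rewrite -[state t w]/((past t w).2) wh.
Qed.

Let stage_cost s (w : trajectory T) : R := cost M (state s w) (action s w).

Let payoff (f : nat -> R) t n (w : trajectory T) : \bar R :=
  (expR (\sum_(t <= s < t + n) stage_cost s w))%:E * (f (state (t + n) w))%:E.

Let measurable_stage_cost s :
  measurable_fun (adm_trajectory M) (stage_cost s).
Proof.
apply: (@measurable_comp _ _ _ _ _ _ [set x : nat * borel T | adm M x.1 x.2]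
  (fun x : nat * borel T => cost M x.1 x.2) _ (fun w : trajectory T => w s)).
- exact: measurable_pairs.
- by move=> _ [w wadm <-]; exact: wadm.
- exact: measurable_cost.
- apply: measurable_funTS; exact: measurable_coord.
Qed.

Let measurable_payoff f t n : measurable_fun (adm_trajectory M) (payoff f t n).
Proof.
apply: emeasurable_funM.
  apply/measurable_EFinP; apply: measurableT_comp; first exact: measurable_expR.
  exact: measurable_sum.
apply/measurable_EFinP; apply: (@measurableT_comp _ _ _ _ _ _ f) => //.
apply: measurable_funTS; exact: measurable_state.
Qed.

Let payoffS f t n w : payoff f t n.+1 w =
  (expR (stage_cost t w))%:E * payoff f t.+1 n w.
Proof.
rewrite /payoff addnS big_ltn ?ltnS ?leq_addr// expRD EFinM addSn.
by rewrite muleA.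
Qed.

Let inadmissible_null : Pr (~` adm_trajectory M) = 0.
Proof.
apply/negligibleP; first exact: measurableC (measurable_adm_trajectory M).
have [_ ae_z _] := Pr_law; apply: negligibleS ae_z => w nadm /= wz; apply: nadm.
have hist t : adm_history M (past t w).
  elim: t => [[]//|t IH]; rewrite pastS.
  have -> : w t = ((past t w).2, z t (past t w)).
    by rewrite [LHS]surjective_pairing; congr pair; exact: wz.
  exact: (adm_extend (state t.+1 w) IH).
by move=> t; rewrite wz; exact: (control_adm z (hist t)).
Qed.

(** Up to a null event, the event that the history is [h] splits into countably
many events according to the next state, with the probabilities of
[prob_extend]. A single history is considered at a time, so that no
measurability of the expected payoff as a function of the history is involved. *)
Lemma integral_payoff (f : nat -> R) n t (h : history (T := T) t) :
  (forall j, (0 <= f j)%R) -> adm_history M h ->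
  \int[Pr]_(w in adm_trajectory M `&` at_past h) payoff f t n w =
  Pr (at_past h) * horizon (EFin \o f) n h.
Proof.
move=> f0; have mA := measurable_adm_trajectory M.
have mAh t' (h' : history (T := T) t') : measurable (adm_trajectory M `&` at_past h').
  exact: measurableI.
have pay0 t' n' w : 0 <= payoff f t' n' w.
  by rewrite /payoff -EFinM lee_fin mulr_ge0// expR_ge0.
have mpay t' n' t'' (h' : history (T := T) t'') :
    measurable_fun (adm_trajectory M `&` at_past h') (payoff f t' n').
  by apply: measurable_funS (measurable_payoff f t' n') => // w [].
elim: n t h => [|n IH] t h hh.
  rewrite (eq_integral (cst (f h.2)%:E)); last first.
    move=> w /set_mem[_ wh]; rewrite /payoff addn0 big_geq// expR0 mul1e.
    by rewrite -[state t w]/((past t w).2) wh.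
  rewrite integral_cst// muleC; congr (_ * _).
  rewrite -[in RHS](setUIDK (at_past h) (adm_trajectory M)).
  rewrite measureU0 1?setIC//; first exact: measurableD.
  apply: subset_measure0 inadmissible_null => //; first exact: measurableD.
  by apply: measurableC.
rewrite (@ge0_negligible_integral _ _ _ _ _ (deviation h))//.
have -> : (adm_trajectory M `&` at_past h) `\` deviation h =
    \bigcup_j (adm_trajectory M `&` at_past (extend h j)).
  apply/seteqP; split => w /=.
    move=> [[wadm wh] nd]; exists (state t.+1 w) => //; split=> //.
    apply/past_extend; split=> //.
    by apply: contrapT => wz; apply: nd.
  move=> [j _ [wadm /past_extend[wh wz wj]]]; split; first by split.
  by move=> [_ []].
rewrite ge0_integral_bigcup//; first last.
- move=> j k _ _ [w [[_ /past_extend[_ _ <-]] [_ /past_extend[_ _ <-]]]] //.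
- apply/measurable_fun_bigcup => // j; exact: mpay.
set C := expR (cost M h.2 (z t h)).
have C0 : 0 <= C%:E by rewrite lee_fin expR_ge0.
have hor0 j : 0 <= horizon (EFin \o f) n (extend h j).
  by apply: horizon_ge0 => k; rewrite lee_fin.
transitivity (\sum_(0 <= j <oo) C%:E * (Pr (at_past h) *
    (horizon (EFin \o f) n (extend h j) * transition M h.2 (z t h) [set j]))).
  apply: eq_eseriesr => j _.
  transitivity (\int[Pr]_(w in adm_trajectory M `&` at_past (extend h j))
      (C%:E * payoff f t.+1 n w)).
    apply: eq_integral => w /set_mem[_ /past_extend[wh wz _]].
    rewrite payoffS /stage_cost wz.
    by rewrite -[state t w]/((past t w).2) wh.
  rewrite ge0_integralZl//; [|solve [exact: mAh|exact: mpay]..].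
  rewrite IH; last exact: adm_extend.
  rewrite /at_past prob_extend// -!muleA; congr (_ * (_ * _)); exact: muleC.
have Pfin : Pr (at_past h) \is a fin_num by rewrite fin_num_measure.
rewrite nneseriesZl => [|j _]; last by rewrite !mule_ge0.
rewrite -(fineK Pfin) nneseriesZl => [|j _]; last by rewrite !mule_ge0.
exact: muleCA.
exact: deviation_null.
Qed.

Definition start_history : history (T := T) 0 := ([tuple], i).

Lemma adm_start : adm_history M start_history. Proof. by case. Qed.

Lemma integral_payoff0 (f : nat -> R) n : (forall j, (0 <= f j)%R) ->
  \int[Pr]_(w in adm_trajectory M)
    ((expR (\sum_(s < n) stage_cost s w))%:E * (f (state n w))%:E) =
  horizon (EFin \o f) n start_history.
Proof.
move=> f0; have := integral_payoff n f0 adm_start.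
have Pr1 : Pr (at_past start_history) = 1.
  have [<- _ _] := Pr_law; congr (Pr _); apply/seteqP; split => w /=.
    by move=> [_].
  by move=> wi; rewrite /at_past/= /past wi; congr pair; exact: tuple0.
have PrC : Pr (~` at_past start_history) = 0 by rewrite probability_setC// Pr1 subee.
rewrite Pr1 mul1e => <-.
rewrite (@ge0_negligible_integral _ _ _ _ _ (~` at_past start_history)).
- rewrite setDE setCK; apply: eq_integral => w _.
  by rewrite /payoff add0n big_mkord.
- exact: measurableC.
- exact: measurable_adm_trajectory.
- apply: eq_measurable_fun (measurable_payoff f 0 n) => w _.
  by rewrite /payoff add0n big_mkord.
- by move=> w _; rewrite -EFinM lee_fin mulr_ge0// expR_ge0.
- exact: PrC.
Qed.

(** Costs are nonnegative, so weighting by the exponential cost can only increase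
a probability. *)
Lemma horizon_prob_gt0 n j : 0 < Pr [set w | state n w = j] ->
  0 < horizon (EFin \o \1_[set j]) n start_history.
Proof.
rewrite -integral_payoff0 => [Pj|k]; last by rewrite indicE.
have mS : measurable [set w : trajectory T | state n w = j].
  by rewrite -[[set _ | _]]setTI; exact: (measurable_state n measurableT (Y := [set j])).
apply: lt_le_trans Pj _.
set S := [set w | _]; have mA := measurable_adm_trajectory M.
have -> : Pr S = Pr (S `&` adm_trajectory M).
  rewrite -[in LHS](setUIDK S (adm_trajectory M)) measureU0//.
  - exact: measurableI.
  - exact: measurableD.
  - apply: subset_measure0 inadmissible_null => //; first exact: measurableD.
    exact: measurableC.
rewrite -integral_indic//; apply: ge0_le_integral => //.
- by apply/measurable_EFinP; exact: measurable_indic.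
- apply: eq_measurable_fun (measurable_payoff \1_[set j] 0 n) => w _.
  by rewrite /payoff add0n big_mkord.
- move=> w wadm; rewrite -EFinM lee_fin -[leLHS]mul1r; apply: ler_pM => //.
  rewrite -expR0 ler_expR; apply: sumr_ge0 => s _; apply: cost_ge0.
  exact: wadm.
Qed.

End expectation.

(** * Random itineraries on the unit interval *)

Section cylinder_intervals.
Context {R : realType}.
Variable q : seq nat -> nat -> R.
Hypothesis q_ge0 : forall r j, (0 <= q r j)%R.
Hypothesis q_sum : forall r, \sum_(0 <= j <oo) (q r j)%:E = 1.

(** Sequences of states are listed with the most recent one first. The interval of
[r] is cut, from left to right, into pieces of relative lengths [q r 0],
[q r 1], and so on, which are the intervals of the extensions of [r]. *)
Definition cumul r j : R := (\sum_(0 <= k < j) q r k)%R.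

Fixpoint cyl_len r : R := if r is j :: r' then (cyl_len r' * q r' j)%R else 1%R.

Fixpoint cyl_left r : R :=
  if r is j :: r' then (cyl_left r' + cyl_len r' * cumul r' j)%R else 0%R.

Definition cyl r : set R := [set x | (cyl_left r <= x < cyl_left r + cyl_len r)%R].

Lemma cyl_len_ge0 r : (0 <= cyl_len r)%R.
Proof. by elim: r => [|j r IH] /=; rewrite ?ler01// mulr_ge0. Qed.

Lemma cumul_le1 r j : (cumul r j <= 1)%R.
Proof.
rewrite -lee_fin -(q_sum r) /cumul -sumEFin.
by apply: nneseries_lim_ge => k _ _; rewrite lee_fin.
Qed.

Lemma cumul_nd r : {homo cumul r : j k / (j <= k)%N >-> (j <= k)%R}.
Proof.
apply/nondecreasing_seqP => j.
by rewrite /cumul big_nat_recr//= lerDl.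
Qed.

Lemma cyl_left_cons r j :
  (cyl_left (j :: r) + cyl_len (j :: r) = cyl_left r + cyl_len r * cumul r j.+1)%R.
Proof. by rewrite /= /cumul big_nat_recr//= mulrDr addrA. Qed.

Lemma cyl_sub r j : cyl (j :: r) `<=` cyl r.
Proof.
move=> x /andP[l1 l2]; apply/andP; split.
  apply: le_trans l1 => /=; rewrite lerDl mulr_ge0 ?cyl_len_ge0//.
  by rewrite /cumul sumr_ge0.
apply: lt_le_trans l2 _; rewrite cyl_left_cons lerD2l.
by rewrite ler_piMr ?cyl_len_ge0// cumul_le1.
Qed.

Lemma cyl_inj r j k x : cyl (j :: r) x -> cyl (k :: r) x -> j = k.
Proof.
wlog jk : j k / (j < k)%N => [H xj xk|].
  by have [/H->//|/H <-//|//] := ltngtP j k.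
move=> /andP[_ xj] /andP[xk _]; exfalso.
have := le_lt_trans xk xj; rewrite cyl_left_cons /= ltrD2l ltNge.
by rewrite ler_wpM2l ?cyl_len_ge0// cumul_nd.
Qed.

Lemma cyl_cover r x : cyl r x -> exists j, cyl (j :: r) x.
Proof.
move=> /andP[x1 x2].
have len0 : (0 < cyl_len r)%R by rewrite -(ltrD2l (cyl_left r)) addr0 (le_lt_trans x1).
have ex : exists j, (x < cyl_left r + cyl_len r * cumul r j)%R.
  apply/not_existsP => H.
  have : \sum_(0 <= j <oo) (q r j)%:E <= ((x - cyl_left r) / cyl_len r)%:E.
    apply: lime_le.
      by apply: is_cvg_nneseries => j _ _; rewrite lee_fin.
    apply: nearW => j; rewrite sumEFin lee_fin ler_pdivlMr// mulrC.
    by rewrite lerBrDl leNgt; apply/negP/H.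
  rewrite q_sum lee_fin ler_pdivlMr// mul1r lerBrDl => /le_lt_trans/(_ x2).
  by rewrite ltxx.
case: (ex_minnP ex) => [[|j] xj minj].
  by move: xj; rewrite /cumul big_geq// mulr0 addr0 ltNge x1.
exists j; apply/andP; rewrite cyl_left_cons; split => //=.
by rewrite leNgt; apply/negP => /minj; rewrite ltnn.
Qed.

(** Outside the unit interval no piece contains [x], and the default value 0 is
taken at every step. *)
Definition next_state r x : nat := xget 0%N [set j | cyl (j :: r) x].

Fixpoint itinerary t x : seq nat :=
  if t is t'.+1 then next_state (itinerary t' x) x :: itinerary t' x else [::].

Lemma size_itinerary t x : size (itinerary t x) = t.
Proof. by elim: t => //= t ->. Qed.

Lemma cyl_itinerary t x : cyl [::] x -> cyl (itinerary t x) x.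
Proof.
move=> x01; elim: t => //= t /cyl_cover[j xj].
by rewrite /next_state; case: xgetP => [k _ //|/(_ j)].
Qed.

Lemma itinerary_cyl r x : cyl r x -> itinerary (size r) x = r.
Proof.
elim: r => //= j r IH xjr; have xr := cyl_sub xjr; rewrite IH//; congr cons.
by rewrite /next_state; case: xgetP => [k _ xk|/(_ j)//]; exact: cyl_inj xk xjr.
Qed.

Lemma itinerary_out t x : ~ cyl [::] x -> itinerary t x = nseq t 0%N.
Proof.
move=> x01; have nx r : ~ cyl r x by elim: r => // j r IH /cyl_sub.
elim: t => //= t ->; congr cons; rewrite /next_state; case: xgetP => [k _ /nx//|//].
Qed.

Let Omega := measurableTypeR R.

Lemma measurable_cyl r : measurable (cyl r : set Omega).
Proof.
rewrite (_ : cyl r = `[cyl_left r, (cyl_left r + cyl_len r)%R[%classic)//.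
Qed.

Definition itinerary_event r : set Omega := [set x | itinerary (size r) x = r].

Lemma itinerary_eventI r : itinerary_event r `&` cyl [::] = cyl r.
Proof.
apply/seteqP; split => x.
  by move=> [<- x01]; exact: cyl_itinerary.
move=> xr; split; first exact: itinerary_cyl.
by elim: r xr => // j r IH /cyl_sub.
Qed.

Lemma measurable_itinerary_event r : measurable (itinerary_event r).
Proof.
rewrite -(setUIDK (itinerary_event r) (cyl [::])); apply: measurableU.
  by rewrite itinerary_eventI; exact: measurable_cyl.
have [r0|r0] := eqVneq r (nseq (size r) 0%N).
  rewrite (_ : _ `\` _ = ~` cyl [::]); first exact: measurableC (measurable_cyl _).
  apply/seteqP; split => [x [_ //]|x x01]; split => //.
  by rewrite /itinerary_event/= itinerary_out.
rewrite (_ : _ `\` _ = set0)//.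
apply/seteqP; split => // x [xr x01]; move/eqP : r0; apply.
by rewrite -[LHS]xr; exact: itinerary_out.
Qed.

Lemma measurable_itinerary d (U : measurableType d) (g : seq nat -> U) t :
  measurable_fun setT (g \o itinerary t : Omega -> U).
Proof.
move=> _ Y mY; rewrite setTI.
rewrite (_ : _ @^-1` _ = \bigcup_r
    (if (size r == t) && (g r \in Y) then itinerary_event r else set0)).
  apply: countable_bigcupT_measurable => [|r]; first exact: countableP.
  by case: ifP => // _; exact: measurable_itinerary_event.
apply/seteqP; split => x /=.
  move=> gY; exists (itinerary t x) => //.
  by rewrite size_itinerary eqxx (mem_set gY)/= /itinerary_event /= size_itinerary.
by move=> [r _]; case: ifP => // /andP[/eqP <- /set_mem grY] ->.
Qed.

Definition unif01 : probability Omega R := uniform_prob (@ltr01 R).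

Lemma unif01_cyl r : unif01 (cyl r) = (cyl_len r)%:E.
Proof.
have cyl01 x : cyl r x -> cyl [::] x.
  by elim: r => [//|j r IH /cyl_sub]; exact: IH.
have mr := measurable_cyl r.
rewrite /unif01 /= /uniform_prob (eq_integral (cst 1)) => [|x /set_mem /cyl01].
  rewrite integral_cst// mul1e.
  rewrite (_ : cyl r = `[cyl_left r, (cyl_left r + cyl_len r)%R[%classic)//.
  apply: etrans (lebesgue_measure_itv _) _.
  rewrite /= lte_fin ltrDl -EFinB addrAC subrr add0r.
  by have := cyl_len_ge0 r; rewrite le_eqVlt => /predU1P[<-|->]; rewrite ?ltxx.
rewrite /cyl /= add0r => /andP[x0 x1].
by rewrite /uniform_pdf x0 (ltW x1) subr0 invr1.
Qed.

Lemma unif01_cyl0 : unif01 (~` cyl [::]) = 0.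
Proof.
by rewrite probability_setC ?unif01_cyl ?subee//; exact: measurable_cyl.
Qed.

Lemma unif01_event r : unif01 (itinerary_event r) = (cyl_len r)%:E.
Proof.
have m0 := measurable_cyl [::].
have mr := measurable_itinerary_event r.
rewrite -(setUIDK (itinerary_event r) (cyl [::])) itinerary_eventI measureU0.
- exact: unif01_cyl.
- exact: measurable_cyl.
- exact: measurableD.
- apply: (@subset_measure0 _ _ _ unif01 _ (~` cyl [::])) => //.
  + exact: measurableD.
  + exact: measurableC.
  + exact: unif01_cyl0.
Qed.

(** Lengths multiply, so [q r] is the law of the next state given the list [r]. *)
Lemma unif01_step r (A : set nat) (p : probability nat R) :
  (forall j, p [set j] = (q r j)%:E) ->
  unif01 (itinerary_event r `&` [set x | A (next_state r x)]) =
  unif01 (itinerary_event r) * p A.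
Proof.
move=> pq; rewrite -mean_indic /mean unif01_event -nneseriesZl => [|j _]; last first.
  by rewrite mule_ge0// lee_fin.
rewrite (_ : _ `&` _ = \bigcup_(j in A) itinerary_event (j :: r)); last first.
  apply/seteqP; split => x /=.
    by move=> [xr Ax]; exists (next_state r x) => //; rewrite /itinerary_event /= xr.
  move=> [j Aj]; rewrite /itinerary_event /= => -[ej er]; rewrite er in ej.
  by split; rewrite ?ej.
rewrite measure_bigcup//=; last 2 first.
- by move=> j _; exact: measurable_itinerary_event.
- by move=> j k _ _ [x []]; rewrite /itinerary_event /= => -[<- xr] [<- _].
rewrite eseries_mkcond; apply: eq_eseriesr => j _.
rewrite indicE; case: ifPn => _; last by rewrite mul0e mule0.
by rewrite unif01_event /= mul1e pq EFinM.
Qed.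

End cylinder_intervals.

(** * Existence of the law of a controlled process *)

Section law_existence.
Context {R : realType} {T : completePseudoMetricType R} (M : dtcmp T).
Variables (z : control M) (i : nat).

Fixpoint sample_history (s : nat -> nat) t : history (T := T) t :=
  if t is t'.+1 then extend z (sample_history s t') (s t') else start_history i.

Lemma eq_sample_history s s' t : (forall k, (k < t)%N -> s k = s' k) ->
  sample_history s t = sample_history s' t.
Proof.
elim: t => //= t IH ss; rewrite ss// IH// => k kt; apply: ss; exact: ltnW.
Qed.

Let states (r : seq nat) k := nth 0%N (rev r) k.

(** The itinerary lists the states that follow the initial one. *)
Definition hist_weight (r : seq nat) (j : nat) : R :=
  let h := sample_history (states r) (size r) in fine (transition M h.2 (z _ h) [set j]).

Let q_ge0 r j : (0 <= hist_weight r j)%R.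
Proof. exact: fine_ge0. Qed.

Let q_sum r : \sum_(0 <= j <oo) (hist_weight r j)%:E = 1.
Proof.
rewrite -(@mean_cst R (transition M (sample_history (states r) (size r)).2
  (z _ (sample_history (states r) (size r)))) 1 ler01).
apply: eq_eseriesr => j _; rewrite mul1e fineK// fin_num_measure//.
Qed.

Let state_seq (x : R) t : nat := next_state hist_weight (itinerary hist_weight t x) x.

Let states_itinerary t x k : (k < t)%N ->
  states (itinerary hist_weight t x) k = state_seq x k.
Proof.
elim: t => //= t IH; rewrite ltnS leq_eqVlt => kt.
rewrite /states rev_cons nth_rcons size_rev size_itinerary.
by case/predU1P: kt => [->|kt]; [rewrite ltnn eqxx|rewrite kt; exact: IH].
Qed.

Let sample_history_itinerary t x :
  sample_history (states (itinerary hist_weight t x)) t =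
  sample_history (state_seq x) t.
Proof. by apply: eq_sample_history => k kt; exact: states_itinerary. Qed.

Definition sample (x : measurableTypeR R) : trajectory T :=
  fun t => let h := sample_history (state_seq x) t in (h.2, z t h).

Let past_sample t x : past t (sample x) = sample_history (state_seq x) t.
Proof.
elim: t => [|t IH]; first by rewrite /past; congr pair; exact: tuple0.
by rewrite pastS IH.
Qed.

Lemma measurable_sample : measurable_fun setT sample.
Proof.
pose G := \bigcup_t preimage_set_system setT
  (fun w : nat -> nat * borel T => w t) measurable.
apply: (@measurability _ _ (measurableTypeR R) (trajectory T) setT sample G erefl).
move=> _ [_ [t _ [Y mY <-]] <-]; rewrite !setTI.
rewrite (_ : _ @^-1` _ =
    ((fun r => let h := sample_history (states r) t in (h.2, z t h)) \o
    itinerary hist_weight t) @^-1` Y); last first.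
  by apply/seteqP; split => x; rewrite /sample /= sample_history_itinerary.
rewrite -[X in measurable X]setTI.
exact: (@measurable_itinerary R hist_weight q_ge0 q_sum).
Qed.

HB.instance Definition _ := isMeasurableFun.Build _ _ _ _ sample measurable_sample.

Definition sample_law : probability (trajectory T) R :=
  distribution (@unif01 R) sample.

Lemma measurable_control_transition t (A : set nat) :
  measurable_fun (@adm_history R T M t)
    (fun h => transition M h.2 (z t h) A).
Proof.
have mfib k : measurable (adm_history M (t := t) `&` snd @^-1` [set k]).
  apply: measurableI; first exact: measurable_adm_history.
  by rewrite -[_ @^-1` _]setTI; exact: measurable_snd.
rewrite (_ : @adm_history R T M t =
    \bigcup_k (adm_history M (t := t) `&` snd @^-1` [set k])); last first.
  by apply/seteqP; split => [h hh|h [k _ []]//]; exists h.2.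
apply/measurable_fun_bigcup => // k.
apply: (eq_measurable_fun (fun h => transition M k (z t h) A)).
  by move=> h /set_mem[_ /= ->].
apply: (@measurable_comp _ _ _ _ _ _ [set x : nat * borel T | adm M x.1 x.2]
  (fun x : nat * borel T => transition M x.1 x.2 A) _ (fun h => (k, z t h))).
- exact: measurable_pairs.
- by move=> _ [h [hh /= hk] <-] /=; rewrite -hk; exact: control_adm.
- exact: measurable_transition.
- apply: (@measurable_comp _ _ _ _ _ _ setT (pair k)) => //.
  exact: measurable_funS (@measurable_adm_history R T M t) _
    (@measurable_control _ _ _ z t).
Qed.

(** The event that the actions obey the control contains the event that history
and action form one of the countably many pairs that can be sampled, which is
measurable because points are. The transition identity is checked on each of
the countably many events on which the itinerary is constant. *)
Lemma sample_lawP (hT : hausdorff_space T) : is_law i z sample_law.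
Proof.
split.
- rewrite -(@probability_setT _ _ _ (@unif01 R)); congr (unif01 _).
  by apply/seteqP; split.
- apply: ae_foralln => t.
  pose C := range (fun r => let h := sample_history (states r) t in (h, z t h)).
  have mC : measurable C.
    apply: countable_measurable => [[h u]|]; last first.
      by apply: card_le_trans (card_image_le _ _) _; exact: countableP.
    rewrite (_ : [set _] = [set h] `*` [set u]); last first.
      by apply/seteqP; split => [_ ->//|[j v] [/= -> ->]].
    apply: measurableX; [exact: measurable_history1|exact: measurable_singleton].
  pose G := (fun w : trajectory T => (past t w, action t w)) @^-1` C.
  have mG : measurable G.
    rewrite -[G]setTI; apply: measurable_fun_pair => //.
      exact: measurable_past.
    exact: measurable_action.
  have GC : sample_law (~` G) = 0.
    rewrite probability_setC//.
    rewrite (_ : sample_law G = 1) ?subee//.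
    rewrite -(@probability_setT _ _ _ (@unif01 R)); congr (unif01 _).
    apply/seteqP; split => // x _; exists (itinerary hist_weight t x) => //=.
    by rewrite sample_history_itinerary past_sample.
  exists (~` G); split => //; first exact: measurableC.
  move=> w /= nw [r _ [wr zr]]; apply: nw; rewrite -wr -zr//.
- move=> t B A mB BM.
  have [mS mT] : measurable_fun setT sample /\ measurable_fun setT (@past R T t).
    by split; [exact: measurable_sample|exact: measurable_past].
  set D := [set w | B (past t w)].
  have mD : measurable D by rewrite -[D]setTI; exact: mT.
  pose f (w : trajectory T) := transition M (state t w) (z t (past t w)) A.
  have mf : measurable_fun D f.
    apply: (@measurable_comp _ _ _ _ _ _ (@adm_history R T M t)
      (fun h => transition M h.2 (z t h) A) _ (@past R T t)).
    - exact: measurable_adm_history.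
    - by move=> _ [w Dw <-]; exact: BM.
    - exact: measurable_control_transition.
    - exact: measurable_funTS.
  rewrite -/f [RHS](ge0_integral_pushforward mS)//.
  set E := sample @^-1` D.
  have mE : measurable E by rewrite -[E]setTI; exact: mS.
  pose A' := [set x | A (state_seq x t)].
  have mA' : measurable (A' : set (measurableTypeR R)).
    have := @measurable_itinerary R hist_weight q_ge0 q_sum _ _ (head 0%N) t.+1.
    by move=> /(_ measurableT A); rewrite setTI; exact.
  pose F n := [set x : measurableTypeR R | pickle (itinerary hist_weight t x) = n].
  have mF n : measurable (F n).
    have := @measurable_itinerary R hist_weight q_ge0 q_sum _ _ pickle t.
    by move=> /(_ measurableT [set n]); rewrite setTI; exact.
  have EF : E = \bigcup_n (E `&` F n).
    rewrite -setI_bigcupr; apply/seteqP; split => [x Ex|x []//].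
    by split=> //; exists (pickle (itinerary hist_weight t x)).
  have tF : trivIset setT (fun n => E `&` F n).
    by move=> m n _ _ [x [[_ <-] [_ <-]]].
  transitivity (unif01 (\bigcup_n (E `&` F n `&` A'))).
    by rewrite -setI_bigcupl -EF.
  rewrite measure_bigcup//=; last 2 first.
  - by move=> n _; exact: measurableI (measurableI _ _ mE (mF n)) mA'.
  - by move=> m n _ _ [x [[[_ <-] _] [[_ <-] _]]].
  rewrite [in RHS]EF ge0_integral_bigcup//; last 2 first.
  - by move=> n; exact: measurableI _ _ mE (mF n).
  - apply: (measurable_funS mE) => [x [n _ []] //|].
    apply: (@measurable_comp _ _ _ _ _ _ D f _ sample) => //.
    + by move=> _ [x Ex <-].
    + exact: measurable_funTS.
  rewrite eseries_mkcond; apply: eq_eseriesr => n _; rewrite in_setT.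
  have [[x0 [Ex0 Fx0]]|none] := pselect (exists x, (E `&` F n) x); last first.
    rewrite (_ : E `&` F n = set0) ?set0I ?measure0 ?integral_set0//.
    by apply/seteqP; split => // x Ex; apply: none; exists x.
  have [r rE] : exists r, itinerary hist_weight t x0 = r by eexists.
  have rt : size r = t by rewrite -rE size_itinerary.
  subst t; have EFr : E `&` F n = itinerary_event hist_weight r.
    apply/seteqP; split => x.
      move=> [_]; rewrite -Fx0 => /(pcan_inj pickleK) xr.
      by rewrite /itinerary_event/= xr.
    move=> xr; split; last by rewrite -Fx0 /F/= xr rE.
    move: Ex0; rewrite /E /D /= !past_sample.
    by rewrite -(sample_history_itinerary _ x) -(sample_history_itinerary _ x0) xr rE.
  pose h := sample_history (states r) (size r).
  have -> : E `&` F n `&` A' =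
      itinerary_event hist_weight r `&` [set x | A (next_state hist_weight r x)].
    rewrite EFr /A' /state_seq; apply/seteqP.
    by split => x [xr Ax]; split => //; move: Ax; rewrite /= xr.
  have pq j : transition M h.2 (z _ h) [set j] = (hist_weight r j)%:E.
    by rewrite fineK// fin_num_measure.
  rewrite EFr [LHS](unif01_step q_ge0 q_sum A pq).
  rewrite (eq_integral (cst (transition M h.2 (z _ h) A))).
    rewrite integral_cst; last exact: (measurable_itinerary_event q_ge0 q_sum).
    exact: muleC.
  move=> x /set_mem xr; rewrite /f /= -[state _ _]/((past (size r) (sample x)).2).
  by rewrite past_sample -sample_history_itinerary xr.
Qed.

End law_existence.

(** * Growth rates of exponential costs *)

Section growth.
Context {R : realType} {T : completePseudoMetricType R} (M : dtcmp T).
Hypotheses (hA : condA M) (hT : hausdorff_space T).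

Lemma law_is_law i (z : control M) : is_law i z (law i z).
Proof. by apply: xgetPex; exists (sample_law z i); exact: sample_lawP. Qed.

Lemma exp_costE i (z : control M) n :
  exp_cost i z n = horizon z (cst 1) n (start_history i).
Proof.
rewrite /exp_cost.
have -> : cst 1 = EFin \o (cst 1%R : nat -> R) by [].
rewrite -(integral_payoff0 hA hT (law_is_law i z)) => [|j]; last exact: ler01.
by apply: eq_integral => w _; rewrite mule1.
Qed.

Lemma horizon_le_succ (z : control M) n t (h : history (T := T) t) :
  adm_history M h -> horizon z (cst 1) n h <= horizon z (cst 1) n.+1 h.
Proof.
elim: n t h => [|n IH] t h hh.
  rewrite /= kern_cst ?ler01// mulr1 lee_fin -expR0 ler_expR.
  by apply: cost_ge0; exact: control_adm.
rewrite [leRHS]/=; apply: le_kern => j; first exact: horizon_ge0.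
by apply: IH; exact: adm_extend.
Qed.

Lemma horizon_nd (z : control M) i :
  {homo (fun n => horizon z (cst 1) n (start_history i)) : m n / (m <= n)%N >-> m <= n}.
Proof.
by apply/nondecreasing_seqP => n; apply: horizon_le_succ; exact: adm_start.
Qed.

Lemma exp_cost_ge1 i (z : control M) n : 1 <= exp_cost i z n.
Proof. by rewrite exp_costE; exact: (horizon_nd z i (leq0n n)). Qed.

Lemma risk_cost_ge0 i (z : control M) : 0 <= risk_cost i z.
Proof.
apply: limf_esup_ge0 => [|n]; first exact: filter_not_empty.
apply: mule_ge0; first by rewrite lee_fin invr_ge0.
by rewrite lne_ge0 exp_cost_ge1.
Qed.

Lemma opt_cost_ge0 : 0 <= opt_cost M.
Proof.
apply: le_ereal_inf_tmp => _ [i _ <-]; apply: le_ereal_inf_tmp => _ [z _ <-].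
exact: risk_cost_ge0.
Qed.

Lemma opt_cost_le i (z : control M) : opt_cost M <= risk_cost i z.
Proof.
apply: ge_ereal_inf; exists (ereal_inf (range (risk_cost (M := M) i))); first by exists i.
by apply: ge_ereal_inf; exists (risk_cost i z) => //; exists z.
Qed.

Lemma opt_cost_lt (x : \bar R) : opt_cost M < x ->
  exists i (z : control M), risk_cost i z < x.
Proof.
by move=> /ereal_inf_lt[_ [i _ <-] /ereal_inf_lt[_ [z _ <-] zx]]; exists i, z.
Qed.

(** A constant factor [K] contributes [ln K / n], which vanishes in the limit. *)
Lemma risk_cost_le i (z : control M) (r K : R) : (1 <= K)%R ->
  (forall n, exp_cost i z n <= (K * expR (r * n%:R))%:E) -> risk_cost i z <= r%:E.
Proof.
move=> K1 eK; apply/lee_addgt0Pr => e e0.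
rewrite /risk_cost /limn_esup limf_esupE; apply: ge_ereal_inf.
pose N := (Num.truncn (ln K / e)).+1.
eexists; first by exists [set n | (N <= n)%N] => //; exists N.
apply: ge_ereal_sup => _ [n /= Nn <-].
have n0 : (0 < n%:R :> R)%R by rewrite ltr0n; exact: leq_ltn_trans Nn.
have K0 : (0 < K)%R by apply: lt_le_trans K1.
rewrite lee_pdivrMl//.
have /le_trans -> // : lne (exp_cost i z n) <= (ln K + r * n%:R)%:E.
  rewrite -[r in leRHS]/r -(expRK (r * n%:R)%R) -lnM ?posrE ?expR_gt0//.
  rewrite -lne_EFin ?mulr_gt0 ?expR_gt0// lee_lne ?in_itv/= ?leey ?andbT//.
    by apply: le_trans (exp_cost_ge1 i z n).
  by rewrite lee_fin mulr_ge0 ?expR_ge0// ltW.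
rewrite -EFinD -EFinM lee_fin mulrDr [in leRHS](mulrC _ r) addrC lerD2l.
rewrite -ler_pdivrMr//; apply/ltW; apply: lt_le_trans (truncnS_gt _) _.
by rewrite ler_nat.
Qed.

(** Exponential costs increase with the horizon; hence the bound for large
horizons gives one for all of them, at the price of a shift. *)
Lemma exp_cost_bound i (z : control M) (r : R) : risk_cost i z < r%:E ->
  exists N, forall n, exp_cost i z n <= (expR (r * (n + N)%:R))%:E.
Proof.
rewrite /risk_cost /limn_esup limf_esupE => /ereal_inf_lt[_ [V [N _ NV] <-] Vr].
have eN n : (N < n)%N -> exp_cost i z n <= (expR (r * n%:R))%:E.
  move=> Nn; have n0 : (0 < n%:R :> R)%R by rewrite ltr0n; exact: leq_ltn_trans Nn.
  have : (n%:R^-1)%:E * lne (exp_cost i z n) <= r%:E.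
    apply: le_trans (ltW Vr); apply: ereal_sup_ubound; exists n => //.
    by apply: NV; exact: ltnW.
  rewrite lee_pdivrMl// -EFinM mulrC => le1.
  rewrite -lee_lne ?in_itv/= ?leey ?andbT ?lee_fin ?expR_ge0//.
    by case: ifPn => [|_]; rewrite ?expRK// leNgt expR_gt0.
  exact: le_trans (exp_cost_ge1 i z n).
exists N.+1 => n; apply: le_trans (eN _ _); last by rewrite addnS ltnS leq_addl.
by rewrite !exp_costE; apply: horizon_nd; exact: leq_addr.
Qed.

End growth.

Section stationary_controls.
Context {R : realType} {T : completePseudoMetricType R} (M : dtcmp T).
Variable v : stationary M.
Implicit Types f g : nat -> \bar R.

Definition skern f i : \bar R := kern M f i (v i).

Lemma iter_skern_ge0 n f : (forall j, 0 <= f j) -> forall j, 0 <= iter n skern f j.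
Proof. by move=> f0; elim: n => [//|n IH] j; exact: kern_ge0. Qed.

Lemma le_iter_skern n f g : (forall j, 0 <= f j) -> (forall j, f j <= g j) ->
  forall j, iter n skern f j <= iter n skern g j.
Proof.
move=> f0 fg; elim: n => [//|n IH] j; apply: le_kern => //.
exact: iter_skern_ge0.
Qed.

Lemma iter_skernZ n (k : R) f : (0 <= k)%R -> (forall j, 0 <= f j) ->
  forall j, iter n skern (fun j => k%:E * f j) j = k%:E * iter n skern f j.
Proof.
move=> k0 f0; elim: n => [//|n IH] j; rewrite !iterS /skern.
rewrite -kernZ; last exact: iter_skern_ge0.
by congr kern; apply/funext => l; exact: IH.
Qed.

Lemma iter_skern_super n (a : R) f : (0 <= a)%R -> (forall j, 0 <= f j) ->
  (forall j, skern f j <= a%:E * f j) ->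
  forall j, iter n skern f j <= (a ^+ n)%:E * f j.
Proof.
move=> a0 f0 fa; elim: n => [|n IH] j; first by rewrite expr0 mul1e.
rewrite iterS; apply: le_trans (_ : skern (fun j => (a ^+ n)%:E * f j) j <= _).
  by apply: le_kern => // l; exact: iter_skern_ge0.
rewrite /skern kernZ// exprSr EFinM -muleA lee_wpmul2l//; last exact: fa.
by rewrite lee_fin exprn_ge0.
Qed.

Lemma horizon_stationary f n t (h : history (T := T) t) :
  horizon (control_of_stationary v) f n h = iter n skern f h.2.
Proof.
elim: n t h => [//|n IH] t h; rewrite iterS /skern /=.
by congr kern; apply/funext => j; rewrite IH.
Qed.

Hypotheses (hA : condA M) (hT : hausdorff_space T).

Lemma risk_cost_stationary_le (W : nat -> R) (r : R) :
  (forall j, 1 <= W j)%R ->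
  (forall j, skern (EFin \o W) j <= (expR r)%:E * (W j)%:E) ->
  forall i, risk_cost i (control_of_stationary v) <= r%:E.
Proof.
move=> W1 Wr i; apply: (risk_cost_le hA hT (W1 i)) => n.
rewrite exp_costE// horizon_stationary.
apply: (le_trans (le_iter_skern n (g := EFin \o W) _ _ _)) => //.
apply: (le_trans (iter_skern_super n (expR_ge0 r) _ Wr _)) => [j|] /=.
  by rewrite lee_fin (le_trans ler01).
by rewrite -EFinM lee_fin -expRM_natr mulrC.
Qed.

Hypothesis v_irr : irreducible v.

Lemma irreducible_iter i j : exists t, 0 < iter t skern (EFin \o \1_[set j]) i.
Proof.
have [t tj] := v_irr i j; exists t.
have := horizon_prob_gt0 hA hT (law_is_law hT i (control_of_stationary v)) tj.
by rewrite horizon_stationary.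
Qed.

Lemma indic_le_scaled f (k : R) j : (forall l, 0 <= f l) -> k%:E <= f j ->
  forall l, k%:E * (\1_[set j] l)%:E <= f l.
Proof.
move=> f0 fk l; rewrite indicE in_set1; case: eqVneq => [->|_].
  by rewrite mule1.
by rewrite mule0.
Qed.

(** Mass at [i0] is seen from every state, since [i0] can be reached from it. *)
Lemma superharmonic_gt0 f (a : R) i0 : (forall j, 0 <= f j) -> (0 <= a)%R ->
  (forall j, skern f j <= a%:E * f j) -> 0 < f i0 -> forall i, 0 < f i.
Proof.
move=> f0 a0 fa fi0 i; have [t ti] := irreducible_iter i i0.
have [k k0 kf] : exists2 k : R, (0 < k)%R & k%:E <= f i0.
  case: (f i0) fi0 => [x x0| |//]; first by exists x.
  by move=> _; exists 1%R => //; exact: leey.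
rewrite lt_neqAle f0 andbT eq_sym; apply/eqP => fi.
have := iter_skern_super t a0 f0 fa i; rewrite fi mule0.
apply/negP; rewrite -ltNge.
have k1 l : 0 <= k%:E * (EFin \o \1_[set i0]) l.
  by rewrite mule_ge0 ?lee_fin ?(ltW k0)// indicE.
apply: lt_le_trans (le_iter_skern t k1 (indic_le_scaled f0 kf) i).
rewrite iter_skernZ ?(ltW k0)// => [|l]; last by rewrite lee_fin indicE.
exact: mule_gt0.
Qed.

(** An infinite value at a state that can be reached from [i] would make the value
at [i] infinite. *)
Lemma superharmonic_fin f (a : R) i : (forall j, 0 <= f j) -> (0 <= a)%R ->
  (forall j, skern f j <= a%:E * f j) -> f i < +oo -> forall j, f j < +oo.
Proof.
move=> f0 a0 fa fi j; have [t ti] := irreducible_iter i j.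
rewrite ltey; apply/eqP => fj.
have bnd k : (0 <= k)%R ->
    k%:E * iter t skern (EFin \o \1_[set j]) i <= (a ^+ t)%:E * f i.
  move=> k0; apply: le_trans (iter_skern_super t a0 f0 fa i).
  rewrite -iter_skernZ// => [|l]; last by rewrite lee_fin indicE.
  apply: le_iter_skern => [l|]; first by rewrite mule_ge0 ?lee_fin// indicE.
  by apply: indic_le_scaled => //; rewrite fj leey.
have : (a ^+ t)%:E * f i \is a fin_num.
  by rewrite fin_numM// ge0_fin_numE.
move: bnd; move: ((a ^+ t)%:E * f i) => [B| |]// bnd _.
move: (iter t _ _ i) ti bnd => [x| |]//; last first.
  by move=> _ /(_ 1%R ler01); rewrite mul1e.
rewrite lte_fin => x0 bnd.
have B0 : (0 <= B)%R by have := bnd 0%R (lexx _); rewrite mul0e lee_fin.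
have := bnd ((B + 1) / x)%R; rewrite -EFinM lee_fin divfK ?gt_eqF//.
by rewrite divr_ge0 ?addr_ge0 ?(ltW x0)// => /(_ isT); rewrite gerDl ler10.
Qed.

End stationary_controls.

(** * Lyapunov functions and upper bounds on the cost *)

Lemma finite_set_bound (R : realType) (K : set nat) (g : nat -> R) :
  finite_set K -> exists2 C : R, (0 <= C)%R & forall i, K i -> (g i <= C)%R.
Proof.
move=> /finite_seqP[s ->]; exists (\sum_(i <- s) `|g i|)%R.
  by rewrite sumr_ge0.
move=> i /= si; rewrite (big_rem i)//=; apply: le_trans (ler_norm _) _.
by rewrite lerDl sumr_ge0.
Qed.

Section lyapunov.
Context {R : realType} {T : completePseudoMetricType R} (M : dtcmp T).

(** The common form of the two drift conditions, once the factor e^{c(i,u)} has been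
absorbed. *)
Definition foster_lyapunov (V : nat -> R) (d C : R) (K : set nat) :=
  [/\ forall i, (1 <= V i)%R, (0 < d)%R, (0 <= C)%R, finite_set K &
    forall i u, adm M i u ->
      kern M (EFin \o V) i u <= (expR (- d) * V i + C * \1_K i)%:E].

Lemma cost_le_sup i u : condA M -> adm M i u ->
  (cost M i u <= sup [set cost M i w | w in adm M i])%R.
Proof.
move=> hA iu; apply: ub_le_sup; last by exists u.
have [w /set_mem iw wmax] :=
  compact_EVT_max (adm_nonempty M i) (adm_compact (d := M) (i := i)) (hA i).1.
by exists (cost M i w) => _ [w' iw' <-]; apply: wmax; exact: mem_set.
Qed.

Lemma kern_le_real (f : nat -> R) i u (a s : R) : (0 <= a)%R ->
  avg M f i u <= a%:E -> (cost M i u <= s)%R ->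
  kern M (EFin \o f) i u <= (expR s * a)%:E.
Proof.
move=> a0 fa cs; rewrite /kern; apply: le_trans (_ : (expR (cost M i u))%:E * a%:E <= _).
  by apply: lee_wpmul2l => //; rewrite lee_fin expR_ge0.
by rewrite -EFinM lee_fin ler_wpM2r// ler_expR.
Qed.

(** If the costs stay below some s < gamma, weighting the drift inequality by
e^s leaves the rate gamma - s. If the rate minus the maximal cost is norm-like,
that difference exceeds 1 outside a finite set, which is added to [K]. *)
Lemma foster_lyapunov_ex : condA M -> condL M -> exists V d C K, foster_lyapunov V d C K.
Proof.
move=> hA [_ [V [C [K [V1 C0 finK VLab]]]]].
have avg_le (b : nat -> R) :
    (forall i, ereal_sup [set avg M V i u | u in adm M i] <= (b i)%:E) ->
    forall i u, adm M i u -> avg M V i u <= (b i)%:E.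
  by move=> Vb i u iu; apply: le_trans (Vb i); apply: ereal_sup_ubound; exists u.
have V0 i : (0 <= V i)%R by exact: le_trans ler01 (V1 i).
case: VLab => [[beta [/andP[b0 b1] /avg_le Vdrift costb]]|[l] /= [l0 ln Vdrift lc]].
- set S := ereal_sup _ in costb.
  have cS i u : adm M i u -> (cost M i u)%:E <= S.
    move=> iu; apply: le_trans (_ : ereal_sup [set (cost M i w)%:E | w in adm M i] <= _).
      by apply: ereal_sup_ubound; exists u.
    by apply: ereal_sup_ubound; exists i.
  have S0 : 0 <= S.
    have [u iu] := adm_nonempty M 0%N.
    by apply: le_trans (cS _ _ iu); rewrite lee_fin; exact: cost_ge0.
  have [s sE] : exists s : R, S = s%:E.
    by exists (fine S); rewrite fineK// ge0_fin_numE// (lt_trans costb)// ltry.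
  rewrite sE in cS S0 costb; rewrite lte_fin in costb.
  have b'0 : (0 < 1 - beta)%R by rewrite subr_gt0.
  exists V, (ln (1 / (1 - beta)) - s)%R, (expR s * C)%R, K; split => //.
  + by rewrite subr_gt0.
  + by rewrite mulr_ge0 ?expR_ge0// ltW.
  move=> i u iu.
  have -> : (expR (- (ln (1 / (1 - beta)) - s)) * V i + expR s * C * \1_K i =
      expR s * ((1 - beta) * V i + C * \1_K i))%R.
    rewrite opprB expRD expRN lnK ?posrE ?divr_gt0// div1r invrK.
    ring.
  apply: kern_le_real; last by rewrite -lee_fin cS.
    by rewrite addr_ge0// mulr_ge0 ?V0 ?(ltW C0) ?(ltW b'0)// indicE.
  exact: Vdrift.
- pose m i := sup [set cost M i u | u in adm M i].
  pose K' := K `|` [set i | (l i - m i <= 1)%R].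
  have finK' : finite_set K' by rewrite finite_setU; split => //; exact: lc.
  have [C' C'0 C'P] := finite_set_bound (fun i => expR (m i) * (C + V i))%R finK'.
  exists V, 1%R, C', K'; split => //.
  move=> i u iu.
  have := avg_le _ Vdrift i u iu.
  rewrite (_ : (1 - (1 - expR (- l i)) = expR (- l i))%R); last by ring.
  move=> Vi.
  have le1 : (expR (- l i) <= 1)%R by rewrite -expR0 ler_expR oppr_le0.
  have a0 : (0 <= C * \1_K i + expR (- l i) * V i)%R.
    by rewrite addr_ge0// mulr_ge0 ?(ltW C0) ?expR_ge0// indicE.
  apply: le_trans (kern_le_real a0 Vi (cost_le_sup hA iu)) _.
  rewrite lee_fin -/(m i) [in leRHS]indicE.
  case: (boolP (i \in K')) => [/set_mem iK'|iK'].
    rewrite mulr1; apply: le_trans (_ : C' <= _)%R; last first.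
      by rewrite lerDr mulr_ge0 ?expR_ge0.
    apply: le_trans (C'P _ iK'); rewrite ler_wpM2l ?expR_ge0// lerD//.
      by rewrite indicE; case: (i \in K); rewrite ?mulr1 ?mulr0// ltW.
    by rewrite ler_piMl.
  have [niK li] : ~ K i /\ (1 < l i - m i)%R.
    split => [iK|]; first by move/negP: iK'; apply; apply/mem_set; left.
    by rewrite ltNge; apply/negP => li; move/negP: iK'; apply; apply/mem_set; right.
  rewrite indicE memNset// !mulr0 add0r addr0 mulrA -expRD ler_wpM2r// ler_expR.
  lra.
Qed.

End lyapunov.

Section supersolutions.
Context {R : realType} {T : completePseudoMetricType R} (M : dtcmp T).
Hypotheses (hA : condA M) (hT : hausdorff_space T).
Variables (V : nat -> R) (d C : R) (K : set nat).
Hypothesis VL : foster_lyapunov M V d C K.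

(** The function [psi] may tend to 0 at infinity, so it does not control exponential
costs by itself. Adding it to [V] with a large factor does: on [K] the constant
[C] is absorbed by the gap between the rates [r] and [r + e]. *)
Lemma risk_cost_le_super (v : stationary M) (psi : nat -> R) (r : R) : (0 <= r)%R ->
  (forall i, 0 < psi i)%R ->
  (forall i, skern v (EFin \o psi) i <= (expR r * psi i)%:E) ->
  forall i, risk_cost i (control_of_stationary v) <= r%:E.
Proof.
move=> r0 psi0 psir i; apply/lee_addgt0Pr => e e0.
have [V1 d0 C0 finK Vdrift] := VL.
have [C' C'0 C'P] := finite_set_bound (fun i => C / psi i)%R finK.
have gap : (0 < expR (r + e) - expR r)%R by rewrite subr_gt0 ltr_expR ltrDl.
(* The least [A] for which [C' + A * expR r] is at most [A * expR (r + e)]. *)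
pose A := (C' / (expR (r + e) - expR r))%R.
have A0 : (0 <= A)%R by rewrite divr_ge0// ltW.
rewrite -EFinD; apply: (risk_cost_stationary_le hA hT (W := fun j => V j + A * psi j)%R).
  by move=> j; rewrite (le_trans (V1 j))// lerDl mulr_ge0// ltW.
move=> j; rewrite /skern.
have -> : EFin \o (fun j => V j + A * psi j)%R =
    (fun j => (EFin \o V) j + A%:E * (EFin \o psi) j).
  by apply/funext => k /=; rewrite EFinD EFinM.
rewrite kernD => [|k|k]; last 2 first.
- by rewrite lee_fin (le_trans ler01).
- by rewrite mule_ge0 ?lee_fin// ltW.
rewrite kernZ; last by move=> k; rewrite lee_fin ltW.
apply: le_trans (leeD (Vdrift j _ (stationary_adm v j))
  (lee_wpmul2l _ (psir j))) _; first by rewrite lee_fin.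
rewrite -!EFinM -EFinD lee_fin.
have CK : (C * \1_K j <= C' * psi j)%R.
  rewrite indicE; case: (boolP (j \in K)) => [/set_mem jK|_].
    rewrite mulr1 -ler_pdivrMr; [exact: C'P|exact: psi0].
  by rewrite mulr0 mulr_ge0// ltW.
have AE : (A * expR (r + e) = C' + A * expR r)%R.
  have -> : C' = (A * (expR (r + e) - expR r))%R by rewrite /A divfK// lt0r_neq0.
  ring.
have eV : (expR (- d) * V j <= expR (r + e) * V j)%R.
  rewrite ler_wpM2r ?(le_trans ler01)// ler_expR; lra.
have -> : (expR (r + e) * (V j + A * psi j) =
  expR (r + e) * V j + (A * expR (r + e)) * psi j)%R by ring.
rewrite AE mulrDl; lra.
Qed.

Lemma opt_cost_fin : opt_cost M < +oo.
Proof.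
have [V1 d0 C0 finK Vdrift] := VL.
have [v vP] := choice (fun i => adm_nonempty M i).
pose w : stationary M := Stationary vP.
apply: le_lt_trans (opt_cost_le 0 (control_of_stationary w)) _.
apply: le_lt_trans (ltry (ln (1 + C))).
apply: (risk_cost_stationary_le hA hT (W := V)) => // j.
apply: le_trans (Vdrift j _ (vP j)) _.
rewrite lnK ?posrE ?ltr_wpDr// -EFinM lee_fin mulrDl mul1r lerD//.
  by rewrite ler_piMl ?(le_trans ler01)// -expR0 ler_expR oppr_le0 ltW.
by rewrite ler_wpM2l// indicE (le_trans _ (V1 j))// lern1 leq_b1.
Qed.

End supersolutions.

(** * First-passage values at the critical rate *)

Lemma kern_sum (R : realType) (T : completePseudoMetricType R) (M : dtcmp T)
    (F : nat -> nat -> \bar R) n i u : (forall k j, 0 <= F k j) ->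
  kern M (fun j => \sum_(k < n) F k j) i u = \sum_(k < n) kern M (F k) i u.
Proof.
move=> F0; elim: n => [|n IH].
  rewrite big_ord0 (_ : (fun _ => _) = cst 0%:E) ?kern_cst ?mulr0//.
  by apply/funext => j; rewrite big_ord0.
rewrite big_ord_recr /= -IH -kernD//; last by move=> j; exact: sume_ge0.
by congr kern; apply/funext => j; rewrite big_ord_recr.
Qed.

Section critical.
Context {R : realType} {T : completePseudoMetricType R} (M : dtcmp T).
Hypotheses (hA : condA M) (hT : hausdorff_space T).
Hypothesis irr : forall v : stationary M, irreducible v.
Variable D : nat -> set T.
Hypotheses (D_compact : forall i, compact (D i)) (D_neq0 : forall i, D i !=set0).
Hypothesis D_adm : forall i, D i `<=` adm M i.

Definition takes_values_in (z : control M) :=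
  forall t (h : history (T := T) t), adm_history M h -> D h.2 (z t h).

(** The stage value of the action prescribed by [z] bounds the minimum over actions,
one step after the other. *)
Lemma value_iter_le_horizon (z : control M) r n t (h : history (T := T) t) :
  takes_values_in z -> adm_history M h ->
  value_iter M D r 1 set0 n h.2 <=
  \sum_(k < n) (expR (- (r * k%:R)))%:E * horizon z (cst 1) k h.
Proof.
move=> zD; elim: n t h => [|n IH] t h hh; first by rewrite big_ord0.
rewrite big_ord_recl /= mulr0 oppr0 expR0 mul1e.
apply: ge_ereal_inf.
exists (stage_value M r 1 set0 (value_iter M D r 1 set0 n) h.2 (z t h)).
  by exists (z t h) => //; exact: zD.
apply: leeD2l; rewrite (eq_bigr (fun k : 'I_n => (expR (- r))%:E *
    kern M (fun j => (expR (- (r * k%:R)))%:E * horizon z (cst 1) k (extend z h j))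
      h.2 (z t h))); last first.
  move=> k _; rewrite kernZ => [|j]; last exact: horizon_ge0.
  rewrite [RHS]muleA -EFinM -[in RHS]expRD /bump leq0n natrD.
  congr ((expR _)%:E * _); rewrite /=; ring.
rewrite -ge0_sume_distrr => [|k _]; last first.
  by apply: kern_ge0 => j; rewrite mule_ge0 ?horizon_ge0 ?lee_fin ?expR_ge0.
apply: lee_wpmul2l; first by rewrite lee_fin expR_ge0.
pose F k j := (expR (- (r * k%:R)))%:E * horizon z (cst 1) k (extend z h j).
have F0 k j : 0 <= F k j by rewrite mule_ge0 ?horizon_ge0 ?lee_fin ?expR_ge0.
rewrite -(kern_sum M n _ _ F0).
apply: le_kern => j; first by apply: stop_ge0; exact: value_iter_ge0.
rewrite /stop in_set0; apply: (IH _ (extend z h j)).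
exact: adm_extend.
Qed.

(** A cost below [r] makes the discounted sum of exponential costs geometric. *)
Lemma discounted_value_fin i (z : control M) r : takes_values_in z ->
  risk_cost i z < r%:E -> value M D r 1 set0 i < +oo.
Proof.
move=> zD zr.
have [r' zr' r'r] : exists2 r' : R, risk_cost i z < r'%:E & (r' < r)%R.
  move: zr; have := risk_cost_ge0 hA hT i z; case: (risk_cost i z) => [x| |]//.
  move=> _; rewrite lte_fin => xr; exists ((x + r) / 2)%R; rewrite ?lte_fin; lra.
have [N zN] := exp_cost_bound hA hT zr'.
pose a := expR (r' - r).
have a1 : (0 < 1 - a)%R by rewrite subr_gt0 /a -[ltRHS]expR0 ltr_expR subr_lt0.
apply: le_lt_trans (ltry (expR (r' * N%:R) / (1 - a))).
apply: ge_ereal_sup => _ [n _ <-].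
apply: le_trans (value_iter_le_horizon r n zD (adm_start M i)) _.
apply: le_trans (_ : (\sum_(k < n) expR (r' * N%:R) * a ^+ k)%R%:E <= _).
  rewrite -sumEFin; apply: lee_sum => k _.
  apply: le_trans (lee_wpmul2l _ (_ : _ <= (expR (r' * (k + N)%:R))%:E)) _.
  - by rewrite lee_fin expR_ge0.
  - by rewrite -exp_costE.
  rewrite -EFinM lee_fin /a -expRM_natr -!expRD ler_expR natrD; lra.
rewrite lee_fin -mulr_sumr ler_wpM2l ?expR_ge0//.
rewrite -[leRHS]mul1r ler_pdivlMr// mulrC -opprB mulNr -subrX1 opprB.
by rewrite gerBl exprn_ge0// expR_ge0.
Qed.

(** Finiteness at one state passes to all the states reached by a minimizing
stationary control, hence to every state. The running reward 1 makes the value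
positive. *)
Lemma supersolution_above i (z : control M) r : takes_values_in z ->
  risk_cost i z < r%:E ->
  exists2 psi : nat -> R, (forall j, 0 < psi j)%R &
    forall j, exists2 u, D j u & kern M (EFin \o psi) j u <= (expR r * psi j)%:E.
Proof.
move=> zD zr; have fin_i := discounted_value_fin zD zr.
pose g := value M D r 1 set0.
have g0 j : 0 <= g j by exact: value_ge0.
have attained j : exists u, D j u /\ stage_value M r 1 set0 g j u <= g j.
  have [u] := value_attained hA D_compact D_neq0 D_adm r set0 ler01 j.
  by exists u.
have [w wP] := choice attained.
pose v : stationary M := Stationary (fun j => D_adm (wP j).1).
have stop_g : stop set0 g = g by apply/funext => j; rewrite /stop in_set0.
have g_super j : skern v g j <= (expR r)%:E * g j.
  rewrite -lee_pdivrMl ?expR_gt0// -expRN; apply: le_trans (wP j).2.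
  by rewrite /stage_value stop_g leeDr.
have g_ge1 j : 1 <= g j.
  apply: le_trans (wP j).2; rewrite /stage_value leeDl// mule_ge0 ?lee_fin ?expR_ge0//.
  by apply: kern_ge0; rewrite stop_g.
have gE j : (fine (g j))%:E = g j.
  rewrite fineK// ge0_fin_numE//.
  exact: (superharmonic_fin hA hT (irr v) g0 (expR_ge0 r) g_super fin_i).
exists (fine \o g) => j.
  by rewrite -lte_fin /= gE (lt_le_trans _ (g_ge1 j)).
exists (w j); first exact: (wP j).1.
have -> : EFin \o (fine \o g) = g by apply/funext => k /=; exact: gE.
by rewrite EFinM /= gE; exact: g_super.
Qed.

Variable i0 : nat.
Variable lam : R.

Lemma stage_value0 r f j u :
  stage_value M r 0 [set i0] f j u = (expR (- r))%:E * kern M (stop [set i0] f) j u.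
Proof. by rewrite /stage_value add0e. Qed.

(** Lowering the rate by [e] costs at most a factor [expR e] per step. This is what
lets bounds at rates above [lam] pass to [lam]. *)
Lemma value_iter_shift e n j : (0 <= e)%R ->
  value_iter M D lam 0 [set i0] n j <=
  (expR (e * n%:R))%:E * value_iter M D (lam + e) 0 [set i0] n j.
Proof.
move=> e0; elim: n j => [|n IH] j; first by rewrite mule0.
rewrite -lee_pdivrMl ?expR_gt0//; apply: le_ereal_inf_tmp => _ [u Du <-].
rewrite lee_pdivrMl ?expR_gt0//.
apply: ge_ereal_inf.
exists (stage_value M lam 0 [set i0] (value_iter M D lam 0 [set i0] n) j u).
  by exists u.
have it0 r k l : 0 <= value_iter M D r 0 [set i0] k l by exact: value_iter_ge0.
have st0 r l : 0 <= stop [set i0] (value_iter M D r 0 [set i0] n) l.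
  exact: stop_ge0.
rewrite !stage_value0; apply: le_trans (_ : (expR (- lam))%:E * ((expR (e * n%:R))%:E *
    kern M (stop [set i0] (value_iter M D (lam + e) 0 [set i0] n)) j u) <= _).
  apply: lee_wpmul2l; first by rewrite lee_fin expR_ge0.
  rewrite -kernZ//; apply: le_kern => // l.
  rewrite /stop; case: ifP => _; last exact: IH.
  by rewrite mule1 lee_fin -expR0 ler_expR mulr_ge0.
rewrite [leLHS]muleA [leRHS]muleA; apply: lee_wpmul2r; first exact: kern_ge0.
rewrite -[leLHS]EFinM -[leRHS]EFinM lee_fin -!expRD ler_expR -natr1; lra.
Qed.

Hypothesis near_lam : forall r : R, (lam < r)%R ->
  exists i, exists2 z : control M, takes_values_in z & risk_cost i z < r%:E.

Lemma stopped_value_le1 : value M D lam 0 [set i0] i0 <= 1.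
Proof.
apply: ge_ereal_sup => _ [n _ <-]; apply/lee_addgt0Pr => eta eta0.
(* With this shift the factor lost in [n] steps is at most [1 + eta]. *)
pose e := (ln (1 + eta) / n.+1%:R)%R.
have ln0 : (0 < ln (1 + eta))%R by rewrite ln_gt0// ltrDl.
have e0 : (0 < e)%R by rewrite divr_gt0.
have [i [z zD zr]] : exists i, exists2 z : control M, takes_values_in z &
    risk_cost i z < (lam + e)%:E by apply: near_lam; rewrite ltrDl.
have [psi psi0 psiP] := supersolution_above zD zr.
pose phi j : \bar R := (psi j / psi i0)%:E.
have phi0 j : 0 <= phi j by rewrite lee_fin divr_ge0// ltW.
have phii0 : phi i0 = 1 by rewrite /phi divff// gt_eqF.
have it_phi : value_iter M D (lam + e) 0 [set i0] n i0 <= phi i0.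
  apply: le_trans (value_iter_le_value _ _ _ _ _ _ _) _.
  apply: value_le => // j; have [u Du uP] := psiP j; exists u => //.
  have -> : stage_value M (lam + e) 0 [set i0] phi j u =
      (expR (- (lam + e)))%:E * kern M phi j u.
    rewrite stage_value0; congr (_ * kern _ _ _ _); apply/funext => k.
    by rewrite /stop in_set1; case: eqVneq => // ->.
  have -> : phi = fun k => ((psi i0)^-1)%:E * (EFin \o psi) k.
    by apply/funext => k; rewrite /phi mulrC EFinM.
  rewrite expRN lee_pdivrMl ?expR_gt0// kernZ; last by move=> k; rewrite lee_fin ltW.
  rewrite [leRHS]muleCA; apply: lee_wpmul2l; first by rewrite lee_fin invr_ge0 ltW.
  by rewrite -EFinM.
apply: le_trans (value_iter_shift n i0 (ltW e0)) _.
apply: le_trans (lee_wpmul2l _ it_phi) _; first by rewrite lee_fin expR_ge0.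
rewrite phii0 mule1 -EFinD lee_fin -[leRHS]lnK ?posrE ?addr_gt0// ler_expR.
rewrite /e -mulrA ler_piMr ?(ltW ln0)// mulrC ler_pdivrMr// mul1r ler_nat//.
Qed.

(** The stopped value, with the reward 1 in place of its value at [i0]: it solves
the eigenvalue equation except possibly at [i0]. Minimality of the value makes
it the least supersolution normalized at [i0]. *)
Lemma critical_supersolution : exists (w : stationary M) (h : nat -> R),
  [/\ forall j, D j (w j), forall j, (0 < h j)%R, h i0 = 1%R,
      forall j, skern w (EFin \o h) j <= (expR lam * h j)%:E &
  [/\ forall j, j <> i0 -> skern w (EFin \o h) j = (expR lam * h j)%:E,
      forall j u, D j u -> skern w (EFin \o h) j <= kern M (EFin \o h) j u &
      forall f : nat -> R, (forall j, 0 <= f j)%R -> f i0 = 1%R ->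
        (forall j, exists2 u, D j u & kern M (EFin \o f) j u <= (expR lam * f j)%:E) ->
        forall j, (h j <= f j)%R]].
Proof.
pose g := value M D lam 0 [set i0].
have g0 j : 0 <= g j by exact: value_ge0.
have gi0 : g i0 <= 1 := stopped_value_le1.
have attained j : exists u, D j u /\ stage_value M lam 0 [set i0] g j u <= g j.
  have [u] := value_attained hA D_compact D_neq0 D_adm lam [set i0] (lexx _) j.
  by exists u.
have [w' wP] := choice attained.
pose w : stationary M := Stationary (fun j => D_adm (wP j).1).
pose H := stop [set i0] g.
have Hi0 : H i0 = 1 by rewrite /H /stop in_set1 eqxx.
have HE j : j <> i0 -> H j = g j by move=> /eqP ji; rewrite /H /stop in_set1 (negbTE ji).
have H0 j : 0 <= H j by exact: stop_ge0.
have gH j : g j <= H j.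
  by have [->|/eqP ji] := eqVneq j i0; [rewrite Hi0|rewrite HE].
have wg j : skern w H j = (expR lam)%:E * g j.
  apply/eqP; rewrite eq_le; apply/andP; split.
    rewrite -lee_pdivrMl ?expR_gt0// -expRN; have := (wP j).2.
    by rewrite stage_value0.
  rewrite -lee_pdivlMl ?expR_gt0// -expRN.
  have := @value_le_stage_value _ _ M D lam 0%R [set i0] (lexx _) _ _ (wP j).1.
  by rewrite stage_value0.
have Hsuper j : skern w H j <= (expR lam)%:E * H j.
  by rewrite wg lee_wpmul2l// lee_fin expR_ge0.
have Hfin j : (fine (H j))%:E = H j.
  rewrite fineK// ge0_fin_numE//.
  by apply: (superharmonic_fin hA hT (irr w) H0 (expR_ge0 lam) Hsuper (i := i0));
    rewrite Hi0 ltry.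
have Hpos j : 0 < H j.
  by apply: (superharmonic_gt0 hA hT (irr w) H0 (expR_ge0 lam) Hsuper (i0 := i0));
    rewrite Hi0 lte01.
exists w, (fine \o H).
have -> : EFin \o (fine \o H) = H by apply/funext => j /=; exact: Hfin.
split.
- by move=> j; exact: (wP j).1.
- by move=> j; rewrite -lte_fin /= Hfin.
- by rewrite /= Hi0.
- by move=> j; rewrite EFinM /= Hfin.
split.
- by move=> j ji; rewrite EFinM /= Hfin HE.
- move=> j u Du; rewrite wg -lee_pdivlMl ?expR_gt0// -expRN.
  have := @value_le_stage_value _ _ M D lam 0%R [set i0] (lexx _) _ _ Du.
  by rewrite stage_value0.
- move=> f f0 fi0 fP j; rewrite -lee_fin /= Hfin.
  have stop_f : stop [set i0] (EFin \o f) = EFin \o f.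
    by apply/funext => k; rewrite /stop in_set1; case: eqVneq => // ->; rewrite /= fi0.
  have gf : forall k, g k <= (f k)%:E.
    apply: (@value_le _ _ M D lam 0 [set i0] (lexx _) (EFin \o f)) => [k|k].
      by rewrite lee_fin.
    have [u Du uf] := fP k; exists u => //.
    rewrite stage_value0 stop_f expRN lee_pdivrMl ?expR_gt0//.
  have [->|/eqP ji] := eqVneq j i0; first by rewrite Hi0 fi0.
  by rewrite HE.
Qed.

End critical.

(** * Slack in a supersolution lowers the cost *)

Section criticality.
Context {R : realType} {T : completePseudoMetricType R} (M : dtcmp T).
Hypotheses (hA : condA M) (hT : hausdorff_space T).
Variables (V : nat -> R) (d C : R) (K : set nat).
Hypothesis VL : foster_lyapunov M V d C K.
Variables (w : stationary M) (h : nat -> R) (lam : R) (i0 : nat).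
Hypotheses (w_irr : irreducible w) (lam0 : (0 <= lam)%R).
Hypotheses (h_gt0 : forall j, (0 < h j)%R) (hi0 : h i0 = 1%R).
Hypothesis h_super : forall j, skern w (EFin \o h) j <= (expR lam * h j)%:E.
Variable kappa : R.
Hypothesis h_le : forall j, (h j <= kappa * V j)%R.
Hypothesis strict : skern w (EFin \o h) i0 < (expR lam)%:E.

(** Normalized so that [h] is superharmonic. *)
Let op (f : nat -> \bar R) j := (expR (- lam))%:E * skern w f j.

Let op_ge0 f j : (forall k, 0 <= f k) -> 0 <= op f j.
Proof. by move=> f0; rewrite mule_ge0 ?lee_fin ?expR_ge0//; exact: kern_ge0. Qed.

Let le_op f g j : (forall k, 0 <= f k) -> (forall k, f k <= g k) -> op f j <= op g j.
Proof.
by move=> f0 fg; apply: lee_wpmul2l; [rewrite lee_fin expR_ge0|exact: le_kern].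
Qed.

Let opD f g j : (forall k, 0 <= f k) -> (forall k, 0 <= g k) ->
  op (fun k => f k + g k) j = op f j + op g j.
Proof.
move=> f0 g0; rewrite /op /skern kernD// ge0_muleDr//; exact: kern_ge0.
Qed.

Let opZ (a : R) f j : (forall k, 0 <= f k) ->
  op (fun k => a%:E * f k) j = a%:E * op f j.
Proof. by move=> f0; rewrite /op /skern kernZ// muleCA. Qed.

Let H0 j : 0 <= (EFin \o h) j. Proof. by rewrite lee_fin ltW. Qed.

Let op_h j : op (EFin \o h) j <= (h j)%:E.
Proof. by rewrite /op expRN lee_pdivrMl ?expR_gt0// -EFinM. Qed.

Let defect : {d0 : R | (0 < d0)%R & op (EFin \o h) i0 + d0%:E <= 1}.
Proof.
have : op (EFin \o h) i0 < 1.
  by rewrite /op expRN lte_pdivrMl ?expR_gt0// mule1.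
have := op_ge0 i0 H0; case: (op _ i0) => [x| |]//.
move=> _; rewrite lte_fin => x1; exists (1 - x)%R; first by rewrite subr_gt0.
by rewrite -EFinD lee_fin addrC subrK.
Qed.

Let d0 : R := s2val defect.
Let d0_gt0 : (0 < d0)%R. Proof. exact: s2valP defect. Qed.

Let spike j : \bar R := d0%:E * (\1_[set i0] j)%:E.

Let spike_ge0 j : 0 <= spike j.
Proof. by rewrite mule_ge0 ?lee_fin ?(ltW d0_gt0)// indicE. Qed.

Let op_h_spike j : op (EFin \o h) j + spike j <= (h j)%:E.
Proof.
rewrite /spike indicE in_set1; case: eqVneq => [->|_]; last by rewrite mule0 adde0.
by rewrite mule1 hi0; exact: s2valP' defect.
Qed.

(** Sums of the first [n] iterates of [op], on [h] and on its slack. *)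
Let sums n : nat -> \bar R := iter n (fun f j => (h j)%:E + op f j) (cst 0).
Let gain n : nat -> \bar R := iter n (fun f j => spike j + op f j) (cst 0).

Let sums_ge0 n j : 0 <= sums n j.
Proof. by elim: n j => [//|n IH] j; rewrite adde_ge0// ?op_ge0//; exact: H0. Qed.

Let gain_ge0 n j : 0 <= gain n j.
Proof. by elim: n j => [//|n IH] j; rewrite adde_ge0// ?op_ge0//. Qed.

(** Summing the inequality between [op h], the slack and [h] over the iterates of
[op]: the slack of the sum accumulates the slack of each term. *)
Let op_sums_gain n j : op (sums n) j + gain n j <= sums n j.
Proof.
elim: n j => [|n IH] j.
  by rewrite /sums /gain /= adde0 /op /skern kern_cst// mulr0 mule0.
have ->: op (sums n.+1) j = op (EFin \o h) j + op (op (sums n)) j.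
  by apply: opD => // k; exact: op_ge0.
rewrite -[gain n.+1 j]/(spike j + op (gain n) j) addeACA.
apply: leeD; first exact: op_h_spike.
rewrite -opD => [|k|//]; last exact: op_ge0.
by apply: le_op => k; [rewrite adde_ge0// op_ge0|exact: IH].
Qed.

Let sums_le n j : sums n j <= (n%:R * h j)%:E.
Proof.
elim: n j => [|n IH] j; first by rewrite mul0r.
rewrite -natr1 mulrDl mul1r addrC EFinD; apply: leeD2l.
apply: le_trans (le_op j (sums_ge0 n) IH) _.
have -> : (fun k => (n%:R * h k)%:E) = (fun k => n%:R%:E * (EFin \o h) k).
  by apply/funext => k; rewrite EFinM.
by rewrite opZ// EFinM; apply: lee_wpmul2l; [rewrite lee_fin|exact: op_h].
Qed.

Let gain_ge n k j : (k < n)%N ->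
  (expR (- lam) ^+ k * d0)%:E * iter k (skern w) (EFin \o \1_[set i0]) j <= gain n j.
Proof.
have i_ge0 l m : 0 <= iter l (skern w) (EFin \o \1_[set i0]) m.
  by apply: iter_skern_ge0 => m'; rewrite lee_fin indicE.
have c0 l : (0 <= expR (- lam) ^+ l * d0)%R.
  by rewrite mulr_ge0 ?exprn_ge0 ?expR_ge0// ltW.
elim: n k j => [//|n IH] [|k] j kn.
  by rewrite expr0 mul1r -[leLHS]/(spike j) leeDl// op_ge0.
apply: le_trans (_ : op (gain n) j <= _); last by rewrite leeDr.
apply: le_trans (le_op j _ (fun l => IH k l kn)) => [|l]; last first.
  by rewrite mule_ge0 ?lee_fin.
rewrite opZ// /op -[skern w _ j]/(iter k.+1 (skern w) _ j) [leRHS]muleA -EFinM.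
by rewrite exprS (_ : (_ * _ * d0 = expR (- lam) ^+ k * d0 * expR (- lam))%R)//; ring.
Qed.

(** On [K], the slack accumulated by [sums n] compensates for the constant [C], as
soon as [n] exceeds the times needed to reach [i0] from the states of [K]. Off
[K], the decrease of [V] dominates, because [sums n] is at most a multiple of
[V]. *)
Lemma strict_lowers_risk : exists2 r : R, (r < lam)%R &
  forall i, risk_cost i (control_of_stationary w) <= r%:E.
Proof.
have [V1 d_gt0 C0 finK Vdrift] := VL.
have V0 j : (0 < V j)%R by exact: lt_le_trans (V1 j).
have [t tP] := choice (fun j => irreducible_iter hA hT w_irr j i0).
have [B B0 BP] := finite_set_bound (fun j => (t j)%:R%R : R) finK.
pose n := (Num.truncn B).+1.
have gain_gt0 j : K j -> 0 < gain n j.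
  move=> Kj; apply: lt_le_trans (gain_ge j (_ : t j < n)%N); last first.
    by rewrite -(ltr_nat R); apply: le_lt_trans (BP _ Kj) (truncnS_gt B).
  by rewrite mule_gt0 ?lte_fin ?mulr_gt0 ?exprn_gt0 ?expR_gt0.
have sE j : (fine (sums n j))%:E = sums n j.
  by rewrite fineK// ge0_fin_numE// (le_lt_trans (sums_le n j)) ?ltry.
have gE j : (fine (gain n j))%:E = gain n j.
  rewrite fineK// ge0_fin_numE// (le_lt_trans _ (_ : sums n j < +oo))//.
    by apply: le_trans (op_sums_gain n j); rewrite leeDr// op_ge0.
  by rewrite (le_lt_trans (sums_le n j)) ?ltry.
have oE j : (fine (op (sums n) j))%:E = op (sums n) j.
  rewrite fineK// ge0_fin_numE ?op_ge0// (le_lt_trans _ (_ : sums n j < +oo))//.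
    by apply: le_trans (op_sums_gain n j); rewrite leeDl.
  by rewrite (le_lt_trans (sums_le n j)) ?ltry.
set s := fine \o sums n; set g := fine \o gain n; set o := fine \o op (sums n).
have ogs j : (o j + g j <= s j)%R by rewrite -lee_fin EFinD /o /g /s /= oE gE sE.
have s_le j : (s j <= n%:R * h j)%R by rewrite -lee_fin /s /= sE.
have s0 j : (0 <= s j)%R by rewrite -lee_fin /s /= sE.
have g0 j : (0 <= g j)%R by rewrite -lee_fin /g /= gE.
have g_gt0 j : K j -> (0 < g j)%R by move=> Kj; rewrite -lte_fin /g /= gE gain_gt0.
have [m m0 mP] := finite_set_bound (fun j => C / g j)%R finK.
have CK j : (C * \1_K j <= m * g j)%R.
  rewrite indicE; case: (boolP (j \in K)) => [/set_mem jK|_].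
    rewrite mulr1 -ler_pdivrMr; [exact: mP|exact: g_gt0].
  by rewrite mulr0 mulr_ge0.
have kappa0 : (0 <= kappa)%R.
  by rewrite -(pmulr_lge0 _ (V0 i0)) (le_trans _ (h_le i0))// ltW.
(* [q * V] bounds [m * s], so that a decrease of [V] by the factor e^{-d} is a
decrease of [V + m * s] by at least the factor [theta]. *)
pose q := (m * (n%:R * kappa))%R.
have q0 : (0 <= q)%R by rewrite !mulr_ge0.
have q1 : (0 < 1 + q)%R by rewrite ltr_wpDr.
have ms_le j : (m * s j <= q * V j)%R.
  rewrite /q -!mulrA ler_wpM2l// (le_trans (s_le j))// ler_wpM2l//.
have e1 : (expR (- d) < 1)%R by rewrite -[ltRHS]expR0 ltr_expR oppr_lt0.
have e0 := expR_gt0 (- d).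
pose theta := ((expR (- d) + q) / (1 + q))%R.
have theta0 : (0 < theta)%R by rewrite divr_gt0// ltr_wpDr.
have theta1 : (theta < 1)%R by rewrite /theta ltr_pdivrMr// mul1r ltrD2r.
exists (lam + ln theta)%R.
  by rewrite gtrDl ln_lt0// theta0.
apply: (risk_cost_stationary_le hA hT (W := fun j => V j + m * s j)%R).
  by move=> j; rewrite (le_trans (V1 j))// lerDl mulr_ge0.
move=> j; rewrite expRD lnK ?posrE// EFinM -muleA -lee_pdivrMl ?expR_gt0// -expRN.
rewrite -[leLHS]/(op _ j).
have -> : EFin \o (fun j => V j + m * s j)%R =
    (fun k => (EFin \o V) k + m%:E * sums n k).
  by apply/funext => k /=; rewrite EFinD EFinM /s /= sE.
rewrite opD => [|k|k]; last 2 first.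
- by rewrite lee_fin ltW.
- by rewrite mule_ge0.
rewrite opZ// -oE.
apply: le_trans (_ : (expR (- d) * V j + C * \1_K j)%:E + m%:E * (o j)%:E <= _).
  apply: leeD => //; apply: le_trans (Vdrift j (w j) (stationary_adm w j)).
  rewrite /op -[leRHS]mul1e; apply: lee_wpmul2r.
    by apply: kern_ge0 => k; rewrite lee_fin ltW.
  by rewrite lee_fin -expR0 ler_expR oppr_le0.
rewrite -!EFinM -EFinD lee_fin.
have -> : (theta * (V j + m * s j) = expR (- d) * V j + m * s j +
    (1 - expR (- d)) / (1 + q) * (q * V j - m * s j))%R.
  by rewrite /theta; field; rewrite gt_eqF.
have le1 : (0 <= (1 - expR (- d)) / (1 + q) * (q * V j - m * s j))%R.
  by rewrite mulr_ge0 ?divr_ge0 ?subr_ge0 ?(ltW e1) ?(ltW q1).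
have le2 : (m * o j + m * g j <= m * s j)%R by rewrite -mulrDr ler_wpM2l.
have := CK j; lra.
Qed.

End criticality.

(** * The eigenfunction and the optimal stationary controls *)

(** The nonnegative function [f - h] has zero average from [i0], which charges all
the other states. *)
Lemma kern_touch (R : realType) (T : completePseudoMetricType R) (M : dtcmp T)
    (i0 : nat) (u : T) (f h : nat -> R) : condB M i0 -> adm M i0 u ->
  (forall j, 0 <= h j)%R -> (forall j, h j <= f j)%R -> h i0 = f i0 ->
  kern M (EFin \o f) i0 u <= kern M (EFin \o h) i0 u ->
  kern M (EFin \o h) i0 u < +oo -> f = h.
Proof.
move=> hB iu h0 hf hfi0 kfh kh; apply/funext => j.
have [->|/eqP ji] := eqVneq j i0; first by rewrite hfi0.
have diff0 k : 0 <= (f k - h k)%:E by rewrite lee_fin subr_ge0.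
have fE : EFin \o f = fun k => (EFin \o h) k + (f k - h k)%:E.
  by apply/funext => k /=; rewrite -EFinD addrC subrK.
have h0' k : 0 <= (EFin \o h) k by rewrite lee_fin.
have kh_fin : kern M (EFin \o h) i0 u \is a fin_num.
  by rewrite ge0_fin_numE//; exact: kern_ge0.
move: kfh; rewrite fE kernD// -leeBrDl// subee// => k0.
have : (f j - h j)%:E * transition M i0 u [set j] <= 0.
  by apply: le_trans k0; exact: (kern_ge_term j iu diff0).
have Pj := hB j u ji iu; apply: contraTeq => fh.
rewrite -ltNge mule_gt0// lte_fin subr_gt0 lt_neqAle hf andbT.
by rewrite eq_sym.
Qed.

Section main.
Context {R : realType} {T : completePseudoMetricType R} (M : dtcmp T).
Variable i0 : nat.
Hypotheses (hT : hausdorff_space T) (hA : condA M) (hB : condB M i0) (hL : condL M).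

Let irr (v : stationary M) : irreducible v. Proof. exact: hL.1. Qed.

Lemma opt_cost_real : exists2 lam : R, (0 <= lam)%R & opt_cost M = lam%:E.
Proof.
have [V [d [C [K VL]]]] := foster_lyapunov_ex hA hL.
have := opt_cost_ge0 hA hT; have := opt_cost_fin hA hT VL.
by case: (opt_cost M) => [x| |]// _ x0; exists x.
Qed.

(** If the eigenvalue equation failed at [i0], a stationary control would cost less
than the optimal cost. The growth bound needed for this, [h <= kappa * V],
follows from minimality: off [K] a large multiple of [V] is a supersolution, so
the minimum of [h] and that multiple is one as well. *)
Lemma minimal_eigenfunction (lam : R) : opt_cost M = lam%:E ->
  exists2 h : nat -> R, eigenfunction M i0 h &
      forall f : nat -> R, (forall j, 0 <= f j)%R -> f i0 = 1%R ->
        (forall j, exists2 u, adm M j u & kern M (EFin \o f) j u <= (expR lam * f j)%:E) ->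
        forall j, (h j <= f j)%R.
Proof.
move=> opt_lam; have lam0 : (0 <= lam)%R.
  by have := opt_cost_ge0 hA hT; rewrite opt_lam lee_fin.
have [V [d [C [K VL]]]] := foster_lyapunov_ex hA hL.
have [V1 d0 C0 finK Vdrift] := VL.
have V0 j : (0 < V j)%R by exact: lt_le_trans (V1 j).
have near r : (lam < r)%R -> exists i, exists2 z : control M,
    takes_values_in (adm M) z & risk_cost i z < r%:E.
  move=> lr; have [|i [z zr]] := @opt_cost_lt _ _ M r%:E.
    by rewrite opt_lam lte_fin.
  by exists i, z => // t h hh; exact: control_adm.
have [w [h [_ h0 hi0 hsuper [heq_out hmin hle]]]] :=
  critical_supersolution hA hT irr (@adm_compact _ _ M) (@adm_nonempty _ _ M)
    (fun i => @subset_refl _ (adm M i)) i0 near.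
suff heq j : skern w (EFin \o h) j = (expR lam * h j)%:E.
  exists h => //; split => // j; rewrite opt_lam -EFinM -heq; split.
    by exists (w j) => //; exact: stationary_adm.
  by move=> u ju; exact: hmin.
have [->{j}|/eqP] := eqVneq j i0; last exact: heq_out.
rewrite hi0 mulr1; apply/eqP; rewrite eq_le.
have := hsuper i0; rewrite hi0 mulr1 => -> /=; rewrite leNgt; apply/negP => strict.
have finK0 : finite_set (K `|` [set i0]) by rewrite finite_setU; split.
have [kappa kappa0 kP] := finite_set_bound h finK0.
have h_le j : (h j <= kappa * V j)%R.
  pose f k := Num.min (h k) (kappa * V k)%R.
  have fh k : (f k <= h k)%R by rewrite ge_min lexx.
  have fV k : (f k <= kappa * V k)%R by rewrite ge_min lexx orbT.
  have f0 k : (0 <= f k)%R by rewrite le_min (ltW (h0 k)) mulr_ge0// ltW.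
  have onK k : (K `|` [set i0]) k -> f k = h k.
    by move=> Kk; apply/min_idPl; rewrite (le_trans (kP _ Kk))// ler_peMr.
  apply: le_trans (fV j); apply: hle => // [|k].
    by rewrite onK//; right.
  exists (w k); first exact: stationary_adm.
  have kern_fh : kern M (EFin \o f) k (w k) <= (expR lam * h k)%:E.
    by apply: le_trans (hsuper k); apply: le_kern => l /=; rewrite lee_fin.
  have [hk|hk] := leP (h k) (kappa * V k)%R.
    by have -> : f k = h k by apply/min_idPl.
  have -> : f k = (kappa * V k)%R by apply/min_idPr/ltW.
  have nKk : ~ K k.
    by move=> Kk; move: hk; rewrite ltNge (le_trans (kP _ _))//; [left|rewrite ler_peMr].
  apply: le_trans (_ : kern M (fun l => kappa%:E * (EFin \o V) l) k (w k) <= _).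
    by apply: le_kern => l /=; rewrite lee_fin.
  rewrite kernZ => [|l]; last by rewrite lee_fin ltW.
  rewrite mulrCA EFinM; apply: lee_wpmul2l => //.
  apply: le_trans (Vdrift _ _ (stationary_adm w k)) _.
  rewrite indicE memNset// mulr0 addr0 lee_fin ler_wpM2r ?(ltW (V0 _))//.
  rewrite ler_expR; lra.
have [r rlam risk_r] :=
  strict_lowers_risk hA hT VL (irr w) lam0 h0 hi0 hsuper h_le strict.
have := le_trans (opt_cost_le 0 (control_of_stationary w)) (risk_r 0%N).
by rewrite opt_lam lee_fin leNgt rlam.
Qed.

Lemma bellman_kern psi i u : bellman M psi i u = kern M (EFin \o psi) i u.
Proof. by []. Qed.

Lemma eigenfunction_eq (lam : R) (h f : nat -> R) : opt_cost M = lam%:E ->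
  eigenfunction M i0 h -> eigenfunction M i0 f -> (forall j, h j <= f j)%R -> f = h.
Proof.
move=> opt_lam [h0 hi0 heq] [f0 fi0 feq] hf.
have [[u iu uf] _] := feq i0; have [_ /(_ u iu) hu] := heq i0.
rewrite opt_lam fi0 mule1 in uf; rewrite opt_lam hi0 mule1 in hu.
apply: (kern_touch hB iu _ hf).
- by move=> j; rewrite ltW.
- by rewrite hi0.
- by rewrite -!bellman_kern uf.
- apply: le_lt_trans (ltry (expR lam)); rewrite -[leRHS]uf.
  by apply: le_kern => j; rewrite lee_fin// ltW.
Qed.

Lemma eigenfunction_super (lam : R) f : opt_cost M = lam%:E -> eigenfunction M i0 f ->
  forall j, exists2 u, adm M j u & kern M (EFin \o f) j u <= (expR lam * f j)%:E.
Proof.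
move=> opt_lam [_ _ feq] j; have [[u ju uE] _] := feq j.
by exists u => //; rewrite -bellman_kern uE opt_lam.
Qed.

Lemma unique_eigenfunction : exists! psi, eigenfunction M i0 psi.
Proof.
have [lam lam0 opt_lam] := opt_cost_real.
have [h h_eig hle] := minimal_eigenfunction opt_lam.
exists h; split => // f f_eig; symmetry; apply: (eigenfunction_eq opt_lam) => //.
have [f0 fi0 _] := f_eig; apply: hle => // [j|]; first exact: ltW.
exact: eigenfunction_super.
Qed.

(** If [v] is optimal, the first-passage value of the process with the single
control [v] is a supersolution for the controlled process. It lies above the
eigenfunction and touches it at [i0], so the two coincide. *)
Lemma optimal_iff_minimizer psi (v : stationary M) : eigenfunction M i0 psi ->
  optimal (control_of_stationary v) <->
  forall i, is_min (adm M i) (bellman M psi i) (bellman M psi i (v i)).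
Proof.
have [lam lam0 opt_lam] := opt_cost_real.
have [h h_eig hle] := minimal_eigenfunction opt_lam.
have [V [d [C [K VL]]]] := foster_lyapunov_ex hA hL.
move=> psi_eig; have <- : h = psi.
  have [f [_ f_unique]] := unique_eigenfunction.
  by rewrite -(f_unique _ h_eig) (f_unique _ psi_eig).
have [h0 hi0 heq] := h_eig.
split => [v_opt|v_min i]; last first.
  apply/eqP; rewrite eq_le opt_cost_le// andbT opt_lam.
  apply: (risk_cost_le_super hA hT VL lam0 h0) => j.
  have [[u ju uE] _] := heq j; have [_ /(_ u ju)] := v_min j.
  by rewrite uE opt_lam -EFinM.
have v_near r : (lam < r)%R -> exists i, exists2 z : control M,
    takes_values_in (fun j => [set v j : T]) z & risk_cost i z < r%:E.
  move=> lr; exists 0%N, (control_of_stationary v) => //.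
  by rewrite v_opt opt_lam lte_fin.
have v_sub j : [set v j : T] `<=` adm M j by move=> _ ->; exact: stationary_adm.
have [w [h' [wv h'0 h'i0 h'super _]]] :=
  critical_supersolution hA hT irr (fun j => @compact_set1 _ (v j : T))
    (fun j => ex_intro _ (v j : T) erefl) v_sub i0 v_near.
have {}h'super j : kern M (EFin \o h') j (v j) <= (expR lam * h' j)%:E.
  by have := h'super j; rewrite /skern (wv j).
have hh' : forall j, (h j <= h' j)%R.
  apply: hle => // j; first exact: ltW.
  by exists (v j) => //; exact: stationary_adm.
have h_le_kern j u : adm M j u -> (expR lam * h j)%:E <= kern M (EFin \o h) j u.
  by move=> ju; have [_ /(_ u ju)] := heq j; rewrite opt_lam.
have h'h : h' = h.
  apply: (kern_touch hB (stationary_adm v i0) _ hh').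
  - by move=> j; rewrite ltW.
  - by rewrite hi0.
  - apply: le_trans (h'super i0) _; rewrite h'i0 -hi0.
    exact/h_le_kern/stationary_adm.
  - apply: le_lt_trans (ltry (expR lam * h' i0)); apply: le_trans (h'super i0).
    by apply: le_kern => j; rewrite lee_fin// ltW.
move=> i; split => [|u iu]; first by exists (v i) => //; exact: stationary_adm.
rewrite !bellman_kern; apply: le_trans (h_le_kern i u iu).
by have := h'super i; rewrite h'h.
Qed.

End main.

Theorem theorem2p1 (R : realType) (T : completePseudoMetricType R)
    (hT : polish_space T) (M : dtcmp T) (i0 : nat)
    (hA : condA M) (hB : condB M i0) (hL : condL M) :
  (exists! psi : nat -> R, eigenfunction M i0 psi) /\
  (forall psi : nat -> R, eigenfunction M i0 psi ->
   forall v : stationary M,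
     optimal (control_of_stationary v) <->
     forall i, is_min (adm M i) (bellman M psi i) (bellman M psi i (v i))).
Proof.
have hT' := hT.1; split; first exact: (unique_eigenfunction hT' hA hB hL).
by move=> psi psi_eig v; exact: (optimal_iff_minimizer hT' hA hB hL).
Qed.
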